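(* Let $k$ be a field of characteristic $0$, let $\mu\ge 1$, and let $\Lambda=(q_{i,j})_{1\le i,j\le\mu}$ be nonzero elements of $k$ with $q_{i,i}=1$ and $q_{i,j}q_{j,i}=1$ for all $i<j$. Assume that $\Lambda$ generates a free abelian group of rank $\mu(\mu-1)/2$ in $k^\times$. Let $S(X_\mu,Y_\mu)=S(X_\mu,Y_\mu,\Lambda)$ be the quantum Weyl algebra, i.e. the unital associative $k$-algebra generated by $x_1,\dots,x_\mu,y_1,\dots,y_\mu$ subject to the relations $$x_ix_j=q_{i,j}x_jx_i,\quad y_iy_j=q_{i,j}y_jy_i,\quad y_jx_i=q_{i,j}x_iy_j\quad (i\ne j),\qquad x_iy_i-y_ix_i+1=0,$$ for $1\le i,j\le\mu$. Then $$HH_n(S(X_\mu,Y_\mu))\cong\begin{cases} k & \text{if } n=2\mu,\\ 0 & \text{otherwise.}\end{cases}$$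
   Context: $HH_n(C)=H_n(C,C)$ denotes the Hochschild homology over $k$ of a unital associative $k$-algebra $C$ with coefficients in itself. *)

(* Defs.v *)
From HB Require Import structures.
From mathcomp Require Import all_boot all_order all_algebra.
From mathcomp Require Import boolp functions.
From mathcomp Require Import finmap monalg.
From mathcomp Require Import zify ring.

Set Implicit Arguments.
Unset Strict Implicit.
Unset Printing Implicit Defensive.

Import GRing.Theory.
Local Open Scope ring_scope.
Local Open Scope quotient_scope.

(* Conversion tests on products and scalings unfold very far; the operations
   below are therefore locked with an opaque key. *)
Fact op_key : unit. Proof. exact: tt. Qed.

(* Membership in a generated submodule is not decidable: [asbool] makes it a
   boolean predicate, which the library's quotients require. *)

Inductive lspan (k : fieldType) (V : lmodType k) (S : V -> Prop) : V -> Prop :=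
| lspan_gen v of S v : lspan S v
| lspan_0 : lspan S 0
| lspan_ZD c u v of lspan S u & lspan S v : lspan S (c *: u + v).

Definition lspan_pred (k : fieldType) (V : lmodType k) (S : V -> Prop)
  : {pred V} := fun v => `[< lspan S v >].

Section LSpan.
Variables (k : fieldType) (V : lmodType k) (S : V -> Prop).

Lemma lspan_submod_closed : submod_closed (lspan_pred S).
Proof.
split; first by apply/asboolP; exact: lspan_0.
by move=> c u v /asboolP Su /asboolP Sv; apply/asboolP; exact: lspan_ZD.
Qed.

HB.instance Definition _ :=
  GRing.isSubmodClosed.Build k V (lspan_pred S) lspan_submod_closed.

(* V / <S> *)
Definition quotmod : Type := Quotient.quot (lspan_pred S).
HB.instance Definition _ := Choice.on quotmod.
HB.instance Definition _ := GRing.Zmodule.on quotmod.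

Definition quot_proj (v : V) : quotmod :=
  \pi_(Quotient.quot (lspan_pred S)) v.

Lemma quot_projP u v : (quot_proj u = quot_proj v) <-> lspan S (u - v).
Proof.
rewrite /quot_proj; split.
  by move/eqP; rewrite -Quotient.idealrBE => /asboolP.
by move=> h; apply/eqP; rewrite -Quotient.idealrBE; apply/asboolP.
Qed.

Lemma quot_projD u v : quot_proj (u + v) = quot_proj u + quot_proj v.
Proof. exact: (raddfD (\pi_(Quotient.quot (lspan_pred S)))). Qed.

Definition quot_repr (x : quotmod) : V :=
  repr (x : Quotient.quot (lspan_pred S)).

Lemma quot_reprK x : quot_proj (quot_repr x) = x.
Proof. exact: reprK. Qed.

Definition quot_scale : k -> quotmod -> quotmod :=
  locked_with op_key (fun c x => quot_proj (c *: quot_repr x)).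

Lemma quot_scaleE c v : quot_scale c (quot_proj v) = quot_proj (c *: v).
Proof.
rewrite /quot_scale unlock.
apply/quot_projP; rewrite -scalerBr -[_ *: _]addr0.
apply: lspan_ZD; last exact: lspan_0.
by apply/quot_projP; rewrite quot_reprK.
Qed.

Fact quot_scaleA a b x : quot_scale a (quot_scale b x) = quot_scale (a * b) x.
Proof. by rewrite -(quot_reprK x) !quot_scaleE scalerA. Qed.
Fact quot_scale1 x : quot_scale 1 x = x.
Proof. by rewrite -(quot_reprK x) quot_scaleE scale1r. Qed.
Fact quot_scaleDr c : {morph quot_scale c : x y / x + y}.
Proof.
move=> x y; rewrite -(quot_reprK x) -(quot_reprK y) -quot_projD !quot_scaleE.
by rewrite scalerDr quot_projD.
Qed.
Fact quot_scaleDl x : {morph quot_scale^~ x : a b / a + b}.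
Proof.
by move=> a b; rewrite -(quot_reprK x) !quot_scaleE scalerDl quot_projD.
Qed.

HB.instance Definition _ := GRing.Zmodule_isLmodule.Build k quotmod
  quot_scaleA quot_scale1 quot_scaleDr quot_scaleDl.

Fact quot_proj_is_linear : linear quot_proj.
Proof. by move=> c u v; rewrite quot_projD -quot_scaleE. Qed.

HB.instance Definition _ := GRing.isLinear.Build k V quotmod _ quot_proj
  quot_proj_is_linear.

Section Lift.
Variables (W : lmodType k) (f : {linear V -> W}).

Definition quot_lift (x : quotmod) : W := f (quot_repr x).

Hypothesis fS : forall v, S v -> f v = 0.

Lemma quot_liftE v : quot_lift (quot_proj v) = f v.
Proof.
have h w : lspan S w -> f w = 0.
  elim=> [{}w /fS //||c x y _ fx _ fy]; first exact: linear0.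
  by rewrite linearP fx fy scaler0 addr0.
apply/eqP; rewrite -subr_eq0 -linearB; apply/eqP/h/quot_projP.
exact: quot_reprK.
Qed.

Lemma quot_lift_is_linear : linear quot_lift.
Proof.
move=> c x y; rewrite -(quot_reprK x) -(quot_reprK y) -linearP !quot_liftE.
exact: linearP.
Qed.

End Lift.
End LSpan.

Section Homology.
Variables (k : fieldType) (U V W : lmodType k).

Definition lker_pred (g : {linear V -> W}) : {pred V} := fun v => g v == 0.

Fact lker_submod_closed g : submod_closed (lker_pred g).
Proof.
split=> [|c u v]; first by apply/eqP; exact: linear0.
by move=> /eqP gu /eqP gv; apply/eqP; rewrite linearP gu gv scaler0 addr0.
Qed.

HB.instance Definition _ g :=
  GRing.isSubmodClosed.Build k V (lker_pred g) (lker_submod_closed g).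

Record lkernel (g : {linear V -> W}) :=
  LKernel { lker_val : V; _ : lker_val \in lker_pred g }.
HB.instance Definition _ g := [isSub for @lker_val g].
HB.instance Definition _ g := [Choice of lkernel g by <:].
HB.instance Definition _ g := [SubChoice_isSubZmodule of lkernel g by <:].
HB.instance Definition _ g := [SubZmodule_isSubLmodule of lkernel g by <:].

(* ker g / im f, for U --f--> V --g--> W *)
Definition homology (f : {linear U -> V}) (g : {linear V -> W}) :=
  quotmod (fun z : lkernel g => exists u, lker_val z = f u).
HB.instance Definition _ f g := GRing.Lmodule.on (homology f g).

Definition cokernel (f : {linear U -> V}) :=
  quotmod (fun v : V => exists u, v = f u).
HB.instance Definition _ f := GRing.Lmodule.on (cokernel f).

End Homology.

Definition lmod_iso (k : fieldType) (U V : lmodType k) : Prop :=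
  exists f : {linear U -> V}, bijective f.

Section Linext.
Variables (k : fieldType) (T : choiceType) (W : lmodType k) (h : T -> W).

Definition linext : {malg k[T]} -> W :=
  locked_with op_key (fun g => \sum_(t <- msupp g) g@_t *: h t).

Lemma linextE g : linext g = \sum_(t <- msupp g) g@_t *: h t.
Proof. by rewrite /linext unlock. Qed.

Lemma linextEw (d : {fset T}) g : (msupp g `<=` d)%fset ->
  linext g = \sum_(t <- d) g@_t *: h t.
Proof.
move=> le; rewrite linextE [LHS](big_fset_incl _ le) => //= x xd /mcoeff_outdom ->.
by rewrite scale0r.
Qed.

Lemma linext_is_linear : linear linext.
Proof.
move=> c u v; pose d := (msupp u `|` msupp v `|` msupp (c *: u + v))%fset.
have du : (msupp u `<=` d)%fset by rewrite /d -fsetUA fsubsetUl.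
have dv : (msupp v `<=` d)%fset by rewrite /d fsetUAC fsubsetUr.
have dcuv : (msupp (c *: u + v) `<=` d)%fset by rewrite /d fsubsetUr.
rewrite (linextEw du) (linextEw dv) (linextEw dcuv).
rewrite scaler_sumr -big_split; apply: eq_bigr => t _ /=.
by rewrite mcoeffD mcoeffZ scalerDl scalerA.
Qed.

HB.instance Definition _ := GRing.isLinear.Build k {malg k[T]} W _ linext
  linext_is_linear.

Lemma linextU t : linext << t >> = h t.
Proof. by rewrite (linextEw msuppU_le) big_seq_fset1 mcoeffUU scale1r. Qed.

End Linext.

Section TensorPower.
Variables (k : fieldType) (V : lmodType k) (n : nat).

Definition ffun_upd (a : {ffun 'I_n -> V}) (i : 'I_n) (u : V) :=
  [ffun j => if j == i then u else a j].

Inductive multilin_rel : {malg k[{ffun 'I_n -> V}]} -> Prop :=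
  MultilinRel a i c u v : multilin_rel
    (<< ffun_upd a i (c *: u + v) >>
       - (c *: << ffun_upd a i u >> + << ffun_upd a i v >>)).

Definition tensorpow := quotmod multilin_rel.
HB.instance Definition _ := GRing.Lmodule.on tensorpow.

Definition tens (a : {ffun 'I_n -> V}) : tensorpow :=
  quot_proj multilin_rel << a >>.

Lemma tensP a i c u v : tens (ffun_upd a i (c *: u + v)) =
  c *: tens (ffun_upd a i u) + tens (ffun_upd a i v).
Proof.
rewrite /tens -linearP; apply/quot_projP; apply: lspan_gen.
exact: MultilinRel.
Qed.

End TensorPower.

Section Hochschild.
Variables (k : fieldType) (A : algType k).

(* The i-th face map on a_0 (x) ... (x) a_(n+1): multiply a_i and a_(i+1) for
   i <= n, and send it to a_(n+1) a_0 (x) a_1 (x) ... (x) a_n for i = n+1.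
   As natural numbers, [lift ord_max j] is j and [lift ord0 j] is j+1. *)
Definition hoch_face n (i : 'I_n.+2) (a : {ffun 'I_n.+2 -> A})
    : {ffun 'I_n.+1 -> A} :=
  [ffun j : 'I_n.+1 =>
     if i == ord_max then
       if j == ord0 then a ord_max * a ord0 else a (lift ord_max j)
     else if (j < i)%N then a (lift ord_max j)
     else if j == i :> nat then a (lift ord_max j) * a (lift ord0 j)
     else a (lift ord0 j)].

Definition hoch_pre n : {malg k[{ffun 'I_n.+2 -> A}]} -> tensorpow A n.+1 :=
  linext (fun a => \sum_(i < n.+2) (-1) ^+ i *: tens (hoch_face i a)).
HB.instance Definition _ n := GRing.Linear.on (@hoch_pre n).

Lemma hoch_face_multilin n (i : 'I_n.+2) a i0 c u v :
  tens (hoch_face i (ffun_upd a i0 (c *: u + v))) =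
  c *: tens (hoch_face i (ffun_upd a i0 u))
    + tens (hoch_face i (ffun_upd a i0 v)).
Proof.
suff [j0 [b [L [Llin E]]]] : exists j0 b (L : A -> A), linear L /\
    forall w, hoch_face i (ffun_upd a i0 w) = ffun_upd b j0 (L w).
  by rewrite !E Llin tensP.
have liftM (j : 'I_n.+1) : lift ord_max j = j :> nat.
  by rewrite /= /bump; have := ltn_ord j; lia.
have lift0' (j : 'I_n.+1) : lift ord0 j = j.+1 :> nat by [].
have ordE m (x y : 'I_m) : (x == y) = (x == y :> nat) by [].
have Lid : linear (id : A -> A) by [].
have Ll (z : A) : linear (fun w => w * z).
  by move=> d x y; rewrite mulrDl scalerAl.
have Lr (z : A) : linear (fun w => z * w).
  by move=> d x y; rewrite mulrDr scalerAr.
have [imax|imax] := eqVneq i ord_max.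
  have [i0max|i0max] := eqVneq i0 ord_max.
    exists ord0, (hoch_face i a), (fun w => w * a ord0); split=> // w.
    apply/ffunP=> j; rewrite !ffunE imax i0max eqxx.
    have -> : (ord0 == ord_max :> 'I_n.+2) = false by [].
    case: ifP => // _.
    suff -> : (lift ord_max j == ord_max) = false by [].
    by rewrite eq_sym; apply/negbTE/neq_lift.
  have lt0 : (i0 < n.+1)%N.
    by move: i0max (ltn_ord i0); rewrite ordE /=; lia.
  have [i00|i00] := eqVneq i0 ord0.
    exists ord0, (hoch_face i a), (fun w => a ord_max * w); split=> // w.
    apply/ffunP=> j; rewrite !ffunE imax i00 !eqxx.
    case: ifP => // /negbT j0.
    suff -> : (lift ord_max j == ord0) = false by [].
    by apply/negbTE; move: j0; rewrite !ordE liftM.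
  exists (Ordinal lt0), (hoch_face i a), id; split=> // w.
  apply/ffunP=> j; rewrite !ffunE imax eqxx.
  have [->|j0] := eqVneq j ord0.
    rewrite ifN; last by rewrite eq_sym.
    rewrite ifN; last by rewrite eq_sym.
    by rewrite ifN // ordE /=; move: i00; rewrite ordE /= eq_sym.
  by rewrite !ordE liftM /=.
have lti : (i < n.+1)%N.
  by move: imax (ltn_ord i); rewrite ordE /=; lia.
exists (inord (if (i0 <= i)%N then nat_of_ord i0 else i0.-1)), (hoch_face i a).
exists (fun w => if i0 == i :> nat then w * a (lift ord0 (Ordinal lti))
  else if i0 == i.+1 :> nat then a i * w else w); split.
  by case: (_ == i :> nat) => //; case: (_ == i.+1 :> nat).
move=> w; apply/ffunP=> j; rewrite !ffunE (negbTE imax) /=.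
have ltj := ltn_ord j; have lti0 := ltn_ord i0.
rewrite (ordE _ j) inordK; last by case: ifP; lia.
rewrite !(ordE _ (lift _ _)) liftM lift0'.
have [ji|ij|ji] := ltngtP j i.
- by have [ii0|ii0|ii0] := ltngtP i0 i; do ![case: eqP => ? //]; lia.
- by have [ii0|ii0|ii0] := ltngtP i0 i; do ![case: eqP => ? //]; lia.
have -> : Ordinal lti = j by apply: val_inj.
have <- : lift ord_max j = i by exact: (val_inj (etrans (liftM j) ji)).
by rewrite !liftM; have [ii0|ii0|ii0] := ltngtP i0 j; do ![case: eqP => ? //]; lia.
Qed.

Lemma hoch_preE n a :
  hoch_pre << a >> = \sum_(i < n.+2) (-1) ^+ i *: tens (hoch_face i a).
Proof. by rewrite /hoch_pre linextU. Qed.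

Lemma hoch_pre_rel n z : multilin_rel z -> @hoch_pre n z = 0.
Proof.
case=> a i c u v; rewrite linearB linearP /= !hoch_preE scaler_sumr.
rewrite -big_split /= -sumrB big1 // => j _.
rewrite hoch_face_multilin scalerDr !scalerA [_ * c]mulrC subrr //.
Qed.

Definition hoch_bd n : tensorpow A n.+2 -> tensorpow A n.+1 :=
  quot_lift (@hoch_pre n).
HB.instance Definition _ n := GRing.isLinear.Build k
  (tensorpow A n.+2) (tensorpow A n.+1) _ (@hoch_bd n)
  (quot_lift_is_linear (@hoch_pre_rel n)).

Lemma hoch_bdE n a :
  hoch_bd (tens a) = \sum_(i < n.+2) (-1) ^+ i *: tens (hoch_face i a).
Proof.
by rewrite /hoch_bd quot_liftE /=; [exact: hoch_preE | exact: hoch_pre_rel].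
Qed.

Definition HH (n : nat) : lmodType k :=
  match n with
  | 0 => cokernel (@hoch_bd 0)
  | m.+1 => homology (@hoch_bd m.+1) (@hoch_bd m)
  end.

End Hochschild.

Section FreeAlgebra.
Variables (k : fieldType) (I : choiceType).

Let malgZU (c z : k) (m : {fmonom I}) :
  c *: << z *g m >> = << c * z *g m >> :> {malg k[{fmonom I}]}.
Proof. by apply/malgP => n; rewrite mcoeffZ !mcoeffU mulrnAr. Qed.

(* k<I>, as the monoid algebra of the free monoid on I *)
Definition freealg := {malg k[{fmonom I}]}.
HB.instance Definition _ := GRing.Lmodule.on freealg.

Definition free_mul : freealg -> freealg -> freealg :=
  locked_with op_key (fun x y : {malg k[{fmonom I}]} => x * y).

Let free_mulE (x y : {malg k[{fmonom I}]}) : free_mul x y = fgmul x y.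
Proof. by rewrite /free_mul unlock. Qed.

Fact free_mulA : associative free_mul.
Proof. by move=> x y z; rewrite !free_mulE; exact: fgmulA. Qed.
Fact free_mul1l : left_id (fgone _ _ : freealg) free_mul.
Proof. by move=> x; rewrite !free_mulE; exact: fgmul1g. Qed.
Fact free_mul1r : right_id (fgone _ _ : freealg) free_mul.
Proof. by move=> x; rewrite !free_mulE; exact: fgmulg1. Qed.
Fact free_mulDl : left_distributive free_mul +%R.
Proof. by move=> x y z; rewrite !free_mulE; exact: fgmulgDl. Qed.
Fact free_mulDr : right_distributive free_mul +%R.
Proof. by move=> x y z; rewrite !free_mulE; exact: fgmulgDr. Qed.
Fact free_1neq0 : fgone _ _ != 0 :> freealg.
Proof. exact: fgoner_eq0. Qed.

HB.instance Definition _ := GRing.Zmodule_isNzRing.Build freealg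
  free_mulA free_mul1l free_mul1r free_mulDl free_mulDr free_1neq0.

Fact free_scalerAl c x y : c *: free_mul x y = free_mul (c *: x) y.
Proof.
rewrite !free_mulE.
rewrite fgmull (fgmullw (msuppZ_le c x) (fsubset_refl _)).
rewrite scaler_sumr; apply: eq_bigr => m _.
rewrite scaler_sumr; apply: eq_bigr => n _.
by rewrite malgZU mcoeffZ mulrA.
Qed.

Fact free_scalerAr c x y : c *: free_mul x y = free_mul x (c *: y).
Proof.
rewrite !free_mulE.
rewrite fgmulr (fgmulrw (fsubset_refl _) (msuppZ_le c y)).
rewrite scaler_sumr; apply: eq_bigr => m _.
rewrite scaler_sumr; apply: eq_bigr => n _.
by rewrite malgZU mcoeffZ mulrCA.
Qed.

HB.instance Definition _ :=
  GRing.Lmodule_isLalgebra.Build k freealg free_scalerAl.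
HB.instance Definition _ :=
  GRing.Lalgebra_isAlgebra.Build k freealg free_scalerAr.

Definition freegen : I -> freealg := locked_with op_key (fun i => << fmu i >>).

Variables (W : lmodType k) (op : I -> {linear W -> W}).

Definition word_act (m : seq I) (w : W) : W := foldr (fun i => op i) w m.

Fact word_act_linear m : linear (word_act m).
Proof.
elim: m => [|i m IH] c u v //.
by rewrite -[LHS]/(op i (word_act m _)) IH linearP.
Qed.

Definition free_act (g : freealg) (w : W) : W :=
  linext (fun m : {fmonom I} => word_act m w) g.

Lemma free_act_linearl w : linear (free_act^~ w).
Proof. exact: linext_is_linear. Qed.

Lemma free_act_linearr g : linear (free_act g).
Proof.
move=> c u v; rewrite /free_act !linextE scaler_sumr -big_split.
apply: eq_bigr => m _ /=.
by rewrite word_act_linear scalerDr !scalerA mulrC.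
Qed.

HB.instance Definition _ g :=
  GRing.isLinear.Build k W W _ (free_act g) (free_act_linearr g).

Lemma free_act0 w : free_act 0 w = 0.
Proof. by rewrite /free_act linear0. Qed.

Lemma free_act1 w : free_act 1 w = w.
Proof. by rewrite /free_act linextU fm1. Qed.

Lemma free_actX i w : free_act (freegen i) w = op i w.
Proof. by rewrite /free_act /freegen unlock linextU fmU. Qed.

Lemma free_actD g h w : free_act (g + h) w = free_act g w + free_act h w.
Proof. by rewrite -{1}[g]scale1r free_act_linearl scale1r. Qed.

Lemma free_actZ c g w : free_act (c *: g) w = c *: free_act g w.
Proof. by rewrite -[c *: g]addr0 free_act_linearl free_act0 addr0. Qed.

Lemma free_actB g h w : free_act (g - h) w = free_act g w - free_act h w.
Proof. by rewrite free_actD -[- h]scaleN1r free_actZ scaleN1r. Qed.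

Lemma free_actM g h w : free_act (g * h) w = free_act g (free_act h w).
Proof.
have U m n : free_act ((<< m >> : freealg) * << n >>) w =
    free_act << m >> (free_act << n >> w).
  rewrite [_ * _]free_mulE fgmulUU mulr1 /free_act !linextU fmM.
  by rewrite /word_act foldr_cat.
have E (f : freealg) : f = \sum_(m <- msupp f) f@_m *: (<< m >> : freealg).
  rewrite {1}[f]monalgE; apply: eq_bigr => m _.
  by rewrite malgZU mulr1.
have D (s : seq {fmonom I}) f v : free_act (\sum_(m <- s) f m) v =
    \sum_(m <- s) free_act (f m) v.
  apply: (big_morph (free_act^~ v)) => [a b|]; last exact: free_act0.
  exact: free_actD.
rewrite (E g) mulr_suml !D; apply: eq_bigr => m _.
rewrite -scalerAl !free_actZ; congr (_ *: _).
rewrite (E h) mulr_sumr !D raddf_sum; apply: eq_bigr => n _.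
by rewrite -scalerAr !free_actZ U -linearZ.
Qed.

Lemma free_act_qcomm i j i' j' c w :
  op i (op j w) = c *: op i' (op j' w) ->
  free_act (freegen i * freegen j - c *: (freegen i' * freegen j')) w = 0.
Proof.
move=> E; rewrite free_actB free_actZ 2!free_actM 4!free_actX.
by apply/eqP; rewrite subr_eq0; apply/eqP.
Qed.

Lemma free_act_weyl i j w :
  op j (op i w) = w + op i (op j w) ->
  free_act (freegen i * freegen j - freegen j * freegen i + 1) w = 0.
Proof.
move=> E; rewrite free_actD free_actB 2!free_actM 4!free_actX free_act1 E.
by rewrite opprD addrCA subrr addr0 addNr.
Qed.

End FreeAlgebra.

Section QuotientAlgebra.
Variables (k : fieldType) (A : algType k) (S : A -> Prop).

Inductive ideal_gen : A -> Prop :=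
  IdealGen a s b of S s : ideal_gen (a * s * b).

Definition ideal : A -> Prop := lspan ideal_gen.

Lemma idealM a z b : ideal z -> ideal (a * z * b).
Proof.
elim=> [_ [c s d Ss]||c u v _ Iu _ Iv].
- by apply: lspan_gen; rewrite !mulrA -mulrA; exact: IdealGen.
- by rewrite mulr0 mul0r; exact: lspan_0.
- by rewrite mulrDr mulrDl -scalerAr -scalerAl; exact: lspan_ZD.
Qed.

Lemma idealD u v : ideal u -> ideal v -> ideal (u + v).
Proof. by rewrite -{2}[u]scale1r; exact: lspan_ZD. Qed.

(* [algType] excludes the zero ring, so the ideal has to be proper. *)
Hypothesis Sproper : ~ ideal 1.

Definition quotalg of ~ ideal 1 : Type := quotmod ideal_gen.
Local Notation Q := (quotalg Sproper).
HB.instance Definition _ := GRing.Lmodule.on Q.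

Definition quotalg_proj : A -> Q := quot_proj ideal_gen.
Local Notation "\p" := quotalg_proj.

Definition quotalg_mul : Q -> Q -> Q :=
  locked_with op_key (fun x y => \p (quot_repr x * quot_repr y)).

Lemma quotalg_mulE a b : quotalg_mul (\p a) (\p b) = \p (a * b).
Proof.
rewrite /quotalg_mul unlock.
apply/quot_projP; set a' := quot_repr _; set b' := quot_repr _.
have Ia : ideal (a' - a) by apply/quot_projP; rewrite quot_reprK.
have Ib : ideal (b' - b) by apply/quot_projP; rewrite quot_reprK.
have -> : a' * b' - a * b = 1 * (a' - a) * b' + a * (b' - b) * 1.
  by rewrite mul1r mulr1 mulrBl mulrBr addrA subrK.
by apply: idealD; exact: idealM.
Qed.

Lemma quotalgW (P : Q -> Prop) : (forall a, P (\p a)) -> forall x, P x.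
Proof. by move=> h x; rewrite -(quot_reprK x); exact: h. Qed.

Let DE a b : \p a + \p b = \p (a + b).
Proof. by rewrite [RHS]quot_projD. Qed.

Fact quotalg_mulA : associative quotalg_mul.
Proof.
elim/quotalgW=> a; elim/quotalgW=> b; elim/quotalgW=> c.
by rewrite !quotalg_mulE mulrA.
Qed.
Fact quotalg_mul1l : left_id (\p 1) quotalg_mul.
Proof. by elim/quotalgW=> a; rewrite !quotalg_mulE mul1r. Qed.
Fact quotalg_mul1r : right_id (\p 1) quotalg_mul.
Proof. by elim/quotalgW=> a; rewrite !quotalg_mulE mulr1. Qed.
Fact quotalg_mulDl : left_distributive quotalg_mul +%R.
Proof.
elim/quotalgW=> a; elim/quotalgW=> b; elim/quotalgW=> c.
by rewrite !(quotalg_mulE, DE) mulrDl.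
Qed.
Fact quotalg_mulDr : right_distributive quotalg_mul +%R.
Proof.
elim/quotalgW=> a; elim/quotalgW=> b; elim/quotalgW=> c.
by rewrite !(quotalg_mulE, DE) mulrDr.
Qed.
Fact quotalg_1neq0 : \p 1 != 0.
Proof.
apply/eqP => p1; apply: Sproper; rewrite -[1]subr0; apply/quot_projP.
by rewrite [LHS]p1 linear0.
Qed.

HB.instance Definition _ := GRing.Zmodule_isNzRing.Build Q
  quotalg_mulA quotalg_mul1l quotalg_mul1r quotalg_mulDl quotalg_mulDr
  quotalg_1neq0.

Let ME a b : \p a * \p b = \p (a * b).
Proof. exact: quotalg_mulE. Qed.

Let ZE c a : c *: \p a = \p (c *: a).
Proof. exact: quot_scaleE. Qed.

Fact quotalg_scalerAl (c : k) (x y : Q) : c *: (x * y) = c *: x * y.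
Proof.
elim/quotalgW: x => a; elim/quotalgW: y => b.
by rewrite ME !ZE ME scalerAl.
Qed.
Fact quotalg_scalerAr (c : k) (x y : Q) : c *: (x * y) = x * (c *: y).
Proof.
elim/quotalgW: x => a; elim/quotalgW: y => b.
by rewrite ME !ZE ME scalerAr.
Qed.

HB.instance Definition _ :=
  GRing.Lmodule_isLalgebra.Build k Q quotalg_scalerAl.
HB.instance Definition _ :=
  GRing.Lalgebra_isAlgebra.Build k Q quotalg_scalerAr.

End QuotientAlgebra.

Lemma free_proper (k : fieldType) (I : choiceType) (S : freealg k I -> Prop)
    (W : lmodType k) (op : I -> {linear W -> W}) (w : W) :
  w <> 0 -> (forall s v, S s -> free_act op s v = 0) -> ~ ideal S 1.
Proof.
move=> w0 Sop I1; apply: w0; rewrite -(free_act1 op w).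
elim: I1 w => [_ [a s b Ss]||c u v _ IHu _ IHv] w.
- by rewrite !free_actM (Sop s) //; exact: (raddf0 (free_act op a)).
- exact: free_act0.
- by rewrite (free_act_linearl op w) IHu IHv scaler0 addr0.
Qed.

Record qparams (k : fieldType) (mu : nat) := QParams {
  qmat :> 'M[k]_mu;
  qmat_neq0 : forall i j, qmat i j != 0;
  qmat_diag : forall i, qmat i i = 1;
  qmat_anti : forall i j : 'I_mu, (i < j)%N -> qmat i j * qmat j i = 1 }.

Section QuantumWeyl.
Variables (k : fieldType) (mu : nat) (q : qparams k mu).

Local Notation F := (freealg k ('I_mu + 'I_mu)%type).
Definition gen_x (i : 'I_mu) : F := freegen k (inl i).
Definition gen_y (i : 'I_mu) : F := freegen k (inr i).
Local Notation x := gen_x.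
Local Notation y := gen_y.

(* [qweyl_rel r]: the relation r = 0 is imposed. *)
Inductive qweyl_rel : F -> Prop :=
| QWeylXX i j of i != j : qweyl_rel (x i * x j - q i j *: (x j * x i))
| QWeylYY i j of i != j : qweyl_rel (y i * y j - q i j *: (y j * y i))
| QWeylYX i j of i != j : qweyl_rel (y j * x i - q i j *: (x i * y j))
| QWeylW i : qweyl_rel (x i * y i - y i * x i + 1).

(* The relations are consistent: they hold for the operators
     x_i v (a) = phi_i(a) v(a + e_i),
     y_i v (a) = - a_i phi_i(a)^-1 v(a - e_i)
   on functions v : Z^mu -> k, where phi_i(a) = prod_(l < i) q_(l,i)^(a_l). *)
Let phi (i : 'I_mu) (a : 'rV[int]_mu) : k :=
  \prod_(l < mu | (l < i)%N) q l i ^ a 0 l.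
Let e (i : 'I_mu) : 'rV[int]_mu := delta_mx 0 i.
Let W : lmodType k := 'rV[int]_mu -> k^o.

Let op_x i (v : W) : W := fun a => phi i a * v (a + e i).
Let op_y i (v : W) : W := fun a => - (a 0 i)%:~R * (phi i a)^-1 * v (a - e i).

Let op_fun (g : 'I_mu + 'I_mu) : W -> W :=
  match g with inl i => op_x i | inr i => op_y i end.

Let op_linear g : linear (op_fun g).
Proof.
case: g => i c u v; apply/funext => a.
  by rewrite /= /op_x [RHS]/= mulrDr; congr (_ + _); exact: mulrCA.
by rewrite /= /op_y [RHS]/= mulrDr; congr (_ + _); exact: mulrCA.
Qed.

Let op g : {linear W -> W} :=
  HB.pack (op_fun g) (GRing.isLinear.Build k W W _ (op_fun g) (op_linear g)).

Let phi_neq0 i a : phi i a != 0.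
Proof. by apply/prodf_neq0 => l _; rewrite expfz_neq0 ?qmat_neq0. Qed.

Let phiD i a b : phi i (a + b) = phi i a * phi i b.
Proof.
rewrite -big_split; apply: eq_bigr => l _ /=.
by rewrite mxE expfzDr ?qmat_neq0.
Qed.

Let phi0 i : phi i 0 = 1.
Proof. by rewrite /phi big1 // => l _; rewrite mxE. Qed.

Let phiN i a : phi i (- a) = (phi i a)^-1.
Proof. by apply: (mulfI (phi_neq0 i a)); rewrite -phiD subrr phi0 divff. Qed.

Let phie i j : phi i (e j) = if (j < i)%N then q j i else 1.
Proof.
rewrite /phi; case: ifP => ji.
  rewrite (bigD1 j) //= big1 ?mulr1 ?mxE ?eqxx // => l /andP[_ lj].
  by rewrite mxE eqxx (negbTE lj).
rewrite big1 // => l li; rewrite mxE eqxx; case: eqP => // lj.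
by rewrite -lj li in ji.
Qed.

Let phiq i j : i != j -> phi j (e i) = q i j * phi i (e j).
Proof.
rewrite !phie neq_ltn => /orP[] ij; rewrite ij ifN ?mulr1 -?leqNgt //.
  exact: ltnW.
by rewrite mulrC qmat_anti.
exact: ltnW.
Qed.

Let qweyl_rel_op r (v : W) : qweyl_rel r -> free_act op r v = 0.
Proof.
have qcomm (g1 g2 g3 g4 : 'I_mu + 'I_mu) (c : k) :
    (forall a, op_fun g1 (op_fun g2 v) a = c * op_fun g3 (op_fun g4 v) a) ->
    free_act op (freegen k g1 * freegen k g2
      - c *: (freegen k g3 * freegen k g4)) v = 0.
  by move=> E; apply: free_act_qcomm; apply/funext => a; exact: E.
have shiftB i j a : i != j -> (a - e i) 0 j = a 0 j.
  by move=> ij; rewrite !mxE eqxx eq_sym (negbTE ij) subr0.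
have shiftD i j a : i != j -> (a + e i) 0 j = a 0 j.
  by move=> ij; rewrite !mxE eqxx eq_sym (negbTE ij) addr0.
have shift1 i a : (a + e i) 0 i = a 0 i + 1 by rewrite !mxE !eqxx.
case=> [i j ij|i j ij|i j ij|i].
- apply: qcomm => a /=; rewrite /op_x !phiD (phiq ij) [a + _ + _]addrAC.
  by move: (phi i a) (phi j a) => ? ?; ring.
- apply: qcomm => a /=; rewrite /op_y !phiD !phiN (phiq ij) [a - _ - _]addrAC.
  rewrite (shiftB i j) // (shiftB j i) 1?eq_sym //.
  move: (phi_neq0 i a) (phi_neq0 j a) (phi_neq0 i (e j)) (qmat_neq0 q i j).
  move: (phi i a) (phi j a) (phi i (e j)) (q i j) (v _) => p1 p2 p3 t w *.
  by field; do !(apply/andP; split).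
- apply: qcomm => a /=; rewrite /op_y /op_x !phiD !phiN (phiq ij).
  rewrite (shiftD i j) // [a - _ + _]addrAC.
  move: (phi_neq0 i a) (phi_neq0 j a) (phi_neq0 i (e j)) (qmat_neq0 q i j).
  move: (phi i a) (phi j a) (phi i (e j)) (q i j) (v _) => p1 p2 p3 t w *.
  by field; do !(apply/andP; split).
apply: free_act_weyl; apply/funext => a.
rewrite -[LHS]/(op_y i (op_x i v) a) -[RHS]/(v a + op_x i (op_y i v) a).
rewrite /op_y /op_x !phiD !phiN phie ltnn shift1.
rewrite subrK addrK rmorphD /= invr1.
move: (phi_neq0 i a); move: (phi i a) (v a) => p w *.
by field.
Qed.

Lemma qweyl_proper : ~ ideal qweyl_rel 1.
Proof.
apply: (@free_proper _ _ _ W op (fun=> 1)); last exact: qweyl_rel_op.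
by move/(congr1 (fun v => v 0)) => /eqP; rewrite oner_eq0.
Qed.

(* S(X_mu, Y_mu, Lambda) with Lambda = q *)
Definition qweyl : algType k := quotalg qweyl_proper.

End QuantumWeyl.

(* For T made of nonzero elements, the subgroup of k^* generated by T. *)
Inductive mul_gen (k : fieldType) (T : k -> Prop) : k -> Prop :=
| mul_gen_in c of T c : mul_gen T c
| mul_gen_1 : mul_gen T 1
| mul_gen_M c d of mul_gen T c & mul_gen T d : mul_gen T (c * d)
| mul_gen_V c of mul_gen T c : mul_gen T c^-1.

(* f is a group isomorphism from the additive group Z^r onto the
   multiplicative group G. *)
Definition free_abelian_of_rank (k : fieldType) (G : k -> Prop) (r : nat) :=
  exists f : 'rV[int]_r -> k,
    [/\ forall a b, f (a + b) = f a * f b, injective f &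
        forall c, G c <-> exists a, f a = c].

(* Main.v *)
From HB Require Import structures.
Require Import Defs.
From mathcomp Require Import all_boot all_order all_algebra.
From mathcomp Require Import boolp functions.
From mathcomp Require Import finmap monalg.
From mathcomp Require Import zify.

(** The quantum Weyl algebra is graded by Z^mu, with x_i of degree e_i and y_i of
    degree - e_i, and its relations are those of the Weyl algebra with all
    commutators twisted by a bicharacter of the degrees. The commutator with
    x_i y_i multiplies an element of degree u by u_i. Inner derivations act
    trivially on Hochschild homology, so in characteristic 0 only the part of
    total degree 0 counts (cartan_cob). In total degree 0 the twist does not
    matter any more, and the Koszul complex is that of the Weyl algebra: the
    twisted commutator with a generator is the partial derivative along the dual
    generator (dtw_mon), so the complex is the tensor product of 2 mu copies of
    the derivative k[t] -> k[t]. The derivative is onto and its kernel is k, in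
    the upper of the two degrees; this gives k in degree 2 mu.

    The Koszul resolution is not constructed. Instead Hochschild cochains are
    embedded into functions with one more free argument, where all cocycles of
    positive degree are coboundaries (cochain_acyclic). They are the common
    kernel there of one operator dop i for each generator, and each operator is
    onto on the common kernel of the previous ones, because of the basis of
    ordered monomials (dop_onto). Each generator thus shifts the cohomology by
    one degree (levelP). What is left at the end are linear forms on the algebra
    modulo transposes of partial derivatives, that is, the value at 1
    (koszul_level, koszul_cob). That ordered monomials are independent also
    follows from these derivatives, and from 1 != 0 (indep_top, indep).

    Cochains take values in an arbitrary vector space. Homology is recovered from
    the universal value: the projection from n-chains to their quotient by the
    boundaries is a cocycle, and if it is a coboundary then every n-cycle is a
    boundary (cycle_boundary). In degree 2 mu the same projection is cohomologous
    to a multiple of one scalar cocycle, which therefore detects the homology,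
    and a cycle on which it is 1 comes from another quotient (top_cycle). *)

Set Implicit Arguments.
Unset Strict Implicit.
Unset Printing Implicit Defensive.

Import GRing.Theory.
Local Open Scope ring_scope.

(** * Iterated degree shifting *)

(** Abstract form of the Koszul argument. C n u are the n-cochains of weight u of
    a complex that is acyclic in positive degrees, and D i are operators on it
    that commute with b and, up to scalars, with each other. Each D i is onto on
    the common kernel of the previous ones. The short exact sequences given by
    D 0, D 1 and so on then shift degrees one at a time, so that the cohomology
    of the common kernel of the first p operators sits in degree p and is the
    quotient of the degree 0 cocycles by the sum of the images of these
    operators. This quotient enters only through the predicates J p, which
    stand for membership in that sum: J_inj says that the D i form a regular
    sequence. *)
Section KoszulShift.
Variables (k : fieldType) (X : lmodType k) (U : zmodType) (M : nat).
Variables (dl : 'I_M -> U) (C : nat -> U -> X -> Prop) (b : X -> X).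
Variables (D : 'I_M -> U -> X -> X) (J : nat -> X -> Prop).

Hypothesis C0 : forall n u, C n u 0.
Hypothesis C_lin : forall n u c F G, C n u F -> C n u G -> C n u (c *: F + G).
Hypothesis b_lin : forall c F G, b (c *: F + G) = c *: b F + b G.
Hypothesis D_lin :
  forall i u c F G, D i u (c *: F + G) = c *: D i u F + D i u G.
Hypothesis C_b : forall n u F, C n u F -> C n.+1 u (b F).
Hypothesis bb : forall n u F, C n u F -> b (b F) = 0.
Hypothesis C_D : forall n u i F, C n u F -> C n (u - dl i) (D i u F).
Hypothesis D_b : forall n u i F, C n u F -> D i u (b F) = b (D i u F).
Hypothesis D_D : forall n u i j F, C n u F -> exists2 c, c != 0 &
  D j (u - dl i) (D i u F) = c *: D i (u - dl j) (D j u F).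

Definition stab (p : nat) u F := forall i : 'I_M, (i < p)%N -> D i u F = 0.
Definition coc n u F := C n u F /\ b F = 0.

Hypothesis C_acyclic : forall n u F, coc n.+1 u F -> exists2 G, C n u G & b G = F.
Hypothesis D_onto : forall n u (i : 'I_M) H,
  C n (u - dl i) H -> stab i (u - dl i) H ->
  exists G, [/\ C n u G, stab i u G & D i u G = H].

Hypothesis J_0 : forall u t, coc 0 u t -> J 0 t -> t = 0.
Hypothesis J_lin : forall p c s t, J p s -> J p t -> J p (c *: s + t).
Hypothesis J_zero : forall p, J p 0.
Hypothesis J_S : forall p t, J p t -> J p.+1 t.
Hypothesis J_D : forall (i : 'I_M) u t, coc 0 u t -> J i.+1 (D i u t).
Hypothesis J_onto : forall (i : 'I_M) u t, coc 0 (u - dl i) t -> J i.+1 t ->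
  exists2 t0, coc 0 u t0 & J i (t - D i u t0).
Hypothesis J_inj : forall (i : 'I_M) u t, coc 0 u t -> J i (D i u t) -> J i t.

Definition cob n p u F := match n with
  | 0 => F = 0
  | n'.+1 => exists G, [/\ C n' u G, stab p u G & b G = F]
  end.

(** The iterated connecting homomorphism, as a relation. If F is a cocycle of
    the p-th complex, then F is b G in the (p-1)-th one, and D G is again a
    cocycle of that complex, one degree lower; after p steps this ends at a
    degree 0 cocycle t. A relation rather than a function spares quotients. *)
Fixpoint zig (p : nat) u F t : Prop := match p with
  | 0 => F = t /\ coc 0 u t
  | p'.+1 => exists i : 'I_M, exists G, [/\ i = p' :> nat,
      C p' u G, stab p' u G, b G = F & stab p'.+1 u F /\
      zig p' (u - dl i) (D i u G) t]
  end.

(** The weight of t when zig p u F t holds. *)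
Definition shift p u := u - \sum_(i < M | (i < p)%N) dl i.

Let b0 : b 0 = 0.
Proof. by have := b_lin (-1) 0 0; rewrite scaler0 addr0 scaleN1r addNr. Qed.
Let D0 i u : D i u 0 = 0.
Proof. by have := D_lin i u (-1) 0 0; rewrite scaler0 addr0 scaleN1r addNr. Qed.
Let DZ i u c F : D i u (c *: F) = c *: D i u F.
Proof. by rewrite -[c *: F]addr0 D_lin D0 addr0. Qed.
Let bB F G : b (F - G) = b F - b G.
Proof. by rewrite addrC -scaleN1r b_lin scaleN1r addrC. Qed.
Let DB i u F G : D i u (F - G) = D i u F - D i u G.
Proof. by rewrite addrC -scaleN1r D_lin scaleN1r addrC. Qed.
Let CB n u F G : C n u F -> C n u G -> C n u (F - G).
Proof. by move=> CF CG; rewrite addrC -scaleN1r; apply: C_lin. Qed.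
Let CZ n u c F : C n u F -> C n u (c *: F).
Proof. by move=> CF; rewrite -[_ *: _]addr0; apply: C_lin. Qed.
Let JZ p c s : J p s -> J p (c *: s).
Proof. by move=> Js; rewrite -[_ *: _]addr0; apply: J_lin. Qed.
Let JZV p c s : c != 0 -> J p (c *: s) -> J p s.
Proof. by move=> c0 /(JZ c^-1); rewrite scalerA mulVf // scale1r. Qed.

Let stab_lin p u c F G :
  stab p u F -> stab p u G -> stab p u (c *: F + G).
Proof. by move=> sF sG i ip; rewrite D_lin sF // sG // scaler0 addr0. Qed.
Let stabB p u F G : stab p u F -> stab p u G -> stab p u (F - G).
Proof. by move=> sF sG; rewrite addrC -scaleN1r; apply: stab_lin. Qed.
Let stabW p u F : stab p.+1 u F -> stab p u F.
Proof. by move=> sF i ip; apply: sF; apply: ltnW. Qed.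
Let stabS (i : 'I_M) u F : stab i u F -> D i u F = 0 -> stab i.+1 u F.
Proof.
move=> sF DF j; rewrite ltnS leq_eqVlt => /orP[/eqP/ord_inj->|] //.
exact: sF.
Qed.
Let stab_D n p u j F : C n u F -> stab p u F -> stab p (u - dl j) (D j u F).
Proof.
by move=> CF sF i ip; have [c _ ->] := D_D j i CF; rewrite sF // D0 scaler0.
Qed.
Let stab_b n p u F : C n u F -> stab p u F -> stab p u (b F).
Proof. by move=> CF sF i ip; rewrite (D_b _ CF) sF. Qed.

Let shift0 u : shift 0 u = u.
Proof. by rewrite /shift big_pred0 ?subr0. Qed.
Let shiftS (i : 'I_M) u : shift i (u - dl i) = shift i.+1 u.
Proof.
rewrite /shift [in RHS](bigD1 i) //= opprD addrA; congr (_ - _).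
apply: eq_bigl => j; rewrite ltnS [(j <= i)%N]leq_eqVlt.
have [->|ne] := eqVneq j i; first by rewrite ltnn andbF.
by rewrite andbT; case: eqP => // /ord_inj e; rewrite e eqxx in ne.
Qed.
Let shiftB p u j : shift p (u - dl j) = shift p u - dl j.
Proof. exact: addrAC. Qed.

Lemma zig_lin p u c F G s t : zig p u F s -> zig p u G t ->
  zig p u (c *: F + G) (c *: s + t).
Proof.
elim: p u F G => [|p IH] u F G /=.
  move=> [-> [Cs bs]] [-> [Ct bt]]; split=> //; split; first exact: C_lin.
  by rewrite b_lin bs bt scaler0 addr0.
move=> [i [F' [ip CF' sF' bF' [sF zF]]]] [j [G' [jp CG' sG' bG' [sG zG]]]].
have {jp}eij : j = i by apply: ord_inj; rewrite /= ip.
rewrite {j}eij in zG.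
exists i, (c *: F' + G'); split=> //; first exact: C_lin.
- exact: stab_lin.
- by rewrite b_lin bF' bG'.
- by split; [exact: stab_lin | rewrite D_lin; exact: IH].
Qed.

Lemma zig_coc p u F t : (p <= M)%N -> zig p u F t ->
  [/\ C p u F, stab p u F, b F = 0 & coc 0 (shift p u) t].
Proof.
elim: p u F => [|p IH] u F pM /=; first by move=> [-> [Ct bt]]; rewrite shift0.
move=> [i [G [ip CG sG <- [sF zG]]]].
have [|_ _ _ ct] := IH _ _ _ zG; first exact: ltnW.
split=> //; [exact: C_b | exact: bb CG | by rewrite -ip -shiftS ip].
Qed.

Let zig0 p u : (p <= M)%N -> zig p u 0 0.
Proof.
elim: p u => [|p IH] u pM /=; first by [].
exists (Ordinal pM), 0; split=> //; split=> //.
by rewrite D0; apply: IH; apply: ltnW.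
Qed.

Let zigZ p u c F t : (p <= M)%N -> zig p u F t -> zig p u (c *: F) (c *: t).
Proof.
by move=> pM z; have := zig_lin c z (zig0 u pM); rewrite !addr0.
Qed.
Let zigB p u F G s t : zig p u F s -> zig p u G t -> zig p u (F - G) (s - t).
Proof.
move=> zF zG; rewrite addrC [s - t]addrC -!scaleN1r; exact: zig_lin.
Qed.

(** The connecting homomorphism is natural for the operators not used yet. *)
Lemma zig_D p u (j : 'I_M) F t : zig p u F t -> (p <= M)%N ->
  exists2 c, c != 0 & zig p (u - dl j) (D j u F) (c *: D j (shift p u) t).
Proof.
elim: p u F => [|p IH] u F /=.
  move=> [-> [Ct bt]] _; exists 1; first exact: oner_neq0.
  rewrite shift0 scale1r; split=> //; split; first exact: C_D.
  by rewrite -(D_b _ Ct) bt D0.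
move=> [i [G [ip CG sG bG [sF zG]]]] pM.
have [|c c0] := IH _ _ zG; first exact: ltnW.
have [c' c'0 eD] := D_D j i CG.
move=> /(zigZ c' (ltnW pM)); rewrite -ip shiftS ip scalerA => z.
exists (c' * c); first by rewrite mulf_neq0.
exists i, (D j u G); split=> //; first exact: C_D.
- exact: stab_D CG sG.
- by rewrite -bG (D_b _ CG).
- split; first by rewrite -bG; apply: stab_D (C_b CG) _; rewrite bG.
  by rewrite eD addrAC.
Qed.

(** What is proved by induction on p: the cohomology is concentrated in degree
    p, and there zig identifies it with the degree 0 cocycles modulo J p. *)
Record level p : Prop := Level {
  level_vanish : forall n u F, n <> p -> C n u F -> stab p u F -> b F = 0 ->
    cob n p u F;
  level_total : forall u F, C p u F -> stab p u F -> b F = 0 ->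
    exists t, zig p u F t;
  level_onto : forall u t, coc 0 (shift p u) t -> exists F, zig p u F t;
  level_cob : forall u F t, zig p u F t -> (J p t <-> cob p p u F) }.

Let level0 : level 0.
Proof.
split.
- case=> // n u F _ CF _ bF; have [|G CG bG] := @C_acyclic n u F; first by [].
  by exists G.
- by move=> u F CF _ bF; exists F.
- by move=> u t; rewrite shift0 => ct; exists t.
- move=> u F t [-> ct]; split; first exact: J_0 ct.
  by move=> /= ->.
Qed.

(** The long exact sequence of 0 -> stab i.+1 -> stab i -> stab i -> 0, the last
    map being D i, written out on cochains. *)
Let level_step (i : 'I_M) : level i -> level i.+1.
Proof.
move=> [van tot onto cobE]; have iM : (i <= M)%N by apply: ltnW.
(* subtracting a coboundary makes G invariant under the next operator *)
have fix_up n u G : C n u G -> stab i u G -> cob n i (u - dl i) (D i u G) ->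
    exists G', [/\ C n u G', stab i.+1 u G' & b G' = b G].
  case: n => [|n] CG sG /=; first by move=> DG; exists G; split=> //; exact: stabS.
  move=> [H [CH sH bH]]; have [H' [CH' sH' DH']] := D_onto CH sH.
  exists (G - b H'); split.
  - by apply: CB => //; apply: C_b.
  - apply: stabS; first by apply: stabB => //; apply: stab_b CH' sH'.
    by rewrite DB (D_b _ CH') DH' bH subrr.
  - by rewrite bB (bb CH') subr0.
have cobD n u G : C n u G -> stab i u G -> b (D i u G) = 0 -> n <> i ->
    cob n i (u - dl i) (D i u G).
  by move=> CG sG bDG ni; apply: van => //; [exact: C_D | exact: stab_D CG sG].
have D_bG n u G F : C n u G -> b G = F -> stab i.+1 u F -> b (D i u G) = 0.
  by move=> CG bG sF; rewrite -(D_b _ CG) bG sF.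
have tot' u F : C i.+1 u F -> stab i.+1 u F -> b F = 0 ->
    exists t, zig i.+1 u F t.
  move=> CF sF bF; have [|G [CG sG bG]] := van _ _ _ _ CF (stabW sF) bF.
    by move/eqP; rewrite (gtn_eqF (ltnSn i)).
  have [|||t zt] := tot (u - dl i) (D i u G).
  - exact: C_D.
  - exact: stab_D CG sG.
  - exact: D_bG CG bG sF.
  by exists t, i, G.
have cob00 n u : cob n i u 0.
  by case: n => // n; exists 0; split.
split=> //.
- move=> n u F ni CF sF bF.
  (* in degree i the class of F is some t with J i (D i t), and J_inj applies *)
  have : cob n i u F.
    have [ni'|ni'] := eqVneq n i; last first.
      by apply: van => //; [exact/eqP | exact: stabW].
    rewrite {}ni' in CF *.
    have [t zt] := tot _ _ CF (stabW sF) bF.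
    apply/(cobE _ _ _ zt).
    have [c c0 zDt] := zig_D i zt iM.
    apply: J_inj; first by have [_ _ _ ct] := zig_coc iM zt; exact: ct.
    by apply: (JZV c0); apply/(cobE _ _ _ zDt); rewrite sF.
  case: n CF ni bF => //= n CF ni bF [G [CG sG bG]].
  rewrite -bG; apply: fix_up => //; apply: cobD => //.
    exact: D_bG CG bG sF.
  by move=> e; rewrite e in ni.
- move=> u t; rewrite -shiftS => ct.
  have [F zF] := onto _ _ ct; have [CF sF bF _] := zig_coc iM zF.
  have [G [CG sG DG]] := D_onto CF sF.
  exists (b G), i, G; rewrite DG; split=> //; split=> //.
  by apply: stabS; [exact: stab_b CG sG | rewrite (D_b _ CG) DG].
move=> u F t [j [G [/ord_inj-> CG sG bG [sF zG]]]] {j}.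
have [_ _ _] := zig_coc iM zG; rewrite shiftB => ct.
split=> [Jt|[G' [CG' sG' bG']]].
  have [t0 ct0 Jt0] := J_onto ct Jt; have [F0 zF0] := onto _ _ ct0.
  have [CF0 sF0 bF0 _] := zig_coc iM zF0.
  have [c c0 zDF0] := zig_D i zF0 iM.
  pose G1 := G - c^-1 *: F0; have CG1 : C i u G1 by apply/CB/CZ.
  have sG1 : stab i u G1.
    by apply: stabB => // j ji; rewrite DZ sF0 // scaler0.
  have bG1 : b G1 = F.
    by rewrite bB bG -[_ *: F0]addr0 b_lin bF0 b0 scaler0 addr0 subr0.
  rewrite -bG1; apply: fix_up => //.
  have z1 : zig i (u - dl i) (D i u G1) (t - c^-1 *: (c *: D i (shift i u) t0)).
    by rewrite DB DZ; apply: zigB => //; apply: zigZ.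
  apply/(cobE _ _ _ z1).
  by rewrite scalerA mulVf // scale1r.
have cGG : C i u (G - G') by apply: CB.
have sGG : stab i u (G - G') by apply: stabB => //; apply: stabW.
have bGG : b (G - G') = 0 by rewrite bB bG bG' subrr.
have [t0 zt0] := tot _ _ cGG sGG bGG.
have [_ _ _ ct0] := zig_coc iM zt0; have [c c0 zDt0] := zig_D i zt0 iM.
have := zigB zG zDt0.
rewrite DB sG' // subr0 subrr => z0.
rewrite -[t](subrK (c *: D i (shift i u) t0)) -[t - _]scale1r.
apply: J_lin; last by apply: JZ; apply: J_D.
by apply: J_S; apply/(cobE _ _ _ z0).
Qed.

Lemma levelP p : (p <= M)%N -> level p.
Proof.
elim: p => [|p IH] pM; first exact: level0.
by apply: (@level_step (Ordinal pM)); apply: IH; apply: ltnW.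
Qed.

End KoszulShift.

(** * Bar cochains *)

(** A cochain is a function F m l of an element m and a list l = [:: c, a1 .. an],
    to be thought of as written on a circle, with m and c adjacent. The
    differential bar multiplies neighbours, except m by c: it computes the
    cohomology of A in the bimodule of linear maps in c and m, which vanishes
    in positive degrees because c is free (bar_pre1). The functions that depend
    only on m * c form the Hochschild complex (wrap, bar_wrap). The values lie
    in any vector space V, which is what makes tensor products and dual spaces
    unnecessary until the very end. *)
Section BarCochains.
Variables (k : fieldType) (A : algType k) (V : lmodType k).
Local Notation X := (A -> seq A -> V).
Implicit Types (F G : X) (m a z : A) (l s : seq A).

Let addE F G m l : (F + G : X) m l = F m l + G m l. Proof. by []. Qed.
Let subE F G m l : (F - G : X) m l = F m l - G m l. Proof. by []. Qed.
Let sclE c F m l : (c *: F : X) m l = c *: F m l. Proof. by []. Qed.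
Let zeroE m l : (0 : X) m l = 0. Proof. by []. Qed.
Let appE := (subE, addE, sclE, zeroE).

(** Fixing the first entry of the list turns bar into a recursion on lists. *)
Definition pre a F : X := fun m l => F m (a :: l).

Fixpoint bar_rec F m a l : V := match l with
  | [::] => F (a * m) [::]
  | a' :: l' => F m (a * a' :: l') - bar_rec (pre a F) m a' l'
  end.

Definition bar F : X := fun m l => if l is a :: l' then bar_rec F m a l' else 0.

Definition mlin F := (forall l, linear (F^~ l)) /\
  forall m l1 l2, linear (fun x => F m (l1 ++ x :: l2)).

(** The failure of F to see only the product m * c, for the generator z and
    up to the scalar lam. *)
Definition twop z (lam : k) F : X := fun m l =>
  if l is c :: s then F m (z * c :: s) - lam *: F (m * z) (c :: s) else 0.

Lemma bar1 F m a : bar F m [:: a] = F (a * m) [::].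
Proof. by []. Qed.

Lemma bar2 F m a a' l :
  bar F m (a :: a' :: l) = F m (a * a' :: l) - bar (pre a F) m (a' :: l).
Proof. by []. Qed.

Lemma bar_lin c F G : bar (c *: F + G) = c *: bar F + bar G.
Proof.
apply/funext => m; apply/funext => -[|a l].
  by rewrite !appE /= scaler0 addr0.
elim: l F G a => [|a' l IH] F G a //.
rewrite !appE !bar2 -[pre a _]/(c *: pre a F + pre a G) IH !appE.
by rewrite scalerBr opprD addrACA.
Qed.

Lemma bar_mulr z F m l : bar (fun m' s => F (m' * z) s) m l = bar F (m * z) l.
Proof.
case: l => // a l; elim: l F a => [|a' l IH] F a; first by rewrite !bar1 mulrA.
by rewrite !bar2 -IH.
Qed.

Lemma barZ c F : bar (c *: F) = c *: bar F.
Proof.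
have e0 : bar 0 = 0.
  by have := bar_lin (-1) 0 0; rewrite scaler0 addr0 scaleN1r addNr.
by rewrite -[c *: F]addr0 bar_lin e0 addr0.
Qed.

Lemma barB F G : bar (F - G) = bar F - bar G.
Proof. by rewrite addrC -scaleN1r bar_lin scaleN1r addrC. Qed.

Let lmul a F : X := fun m l => if l is c :: s then F m (a * c :: s) else F (a * m) [::].

Let pre_bar a F : pre a (bar F) = lmul a F - bar (pre a F).
Proof.
apply/funext => m; apply/funext => -[|a' l] //=.
by rewrite -[RHS]/(F (a * m) [::] - 0) subr0.
Qed.

Let bar_lmul a F m a' l : bar (lmul a F) m (a' :: l) = bar F m (a * a' :: l).
Proof.
case: l => [|a'' l]; first by rewrite !bar1 /= mulrA.
by rewrite !bar2 /= mulrA.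
Qed.

Lemma bar_bar F : bar (bar F) = 0.
Proof.
apply/funext => m; apply/funext => -[|a l] //.
elim: l F a => [|a' l IH] F a //.
rewrite bar2 pre_bar barB.
by rewrite subE IH bar_lmul subr0 subrr.
Qed.

(** Putting 1 at the free place c contracts the complex. *)
Lemma bar_pre1 F : (forall m, F m [::] = 0) -> bar F = 0 -> bar (pre 1 F) = F.
Proof.
move=> F0 bF; apply/funext => m; apply/funext => -[|a l]; first by rewrite F0.
have := congr1 (fun f => f m [:: 1, a & l]) bF.
by rewrite bar2 mul1r => /eqP; rewrite subr_eq0 => /eqP <-.
Qed.

Lemma twop_lin z lam c F G :
  twop z lam (c *: F + G) = c *: twop z lam F + twop z lam G.
Proof.
apply/funext => m; apply/funext => -[|a l].
  by rewrite !appE /= scaler0 addr0.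
rewrite -[LHS]/(c *: F m (z * a :: l) + G m (z * a :: l)
  - lam *: (c *: F (m * z) (a :: l) + G (m * z) (a :: l))).
rewrite -[RHS]/(c *: (F m (z * a :: l) - lam *: F (m * z) (a :: l))
  + (G m (z * a :: l) - lam *: G (m * z) (a :: l))).
by rewrite scalerDr scalerBr !scalerA [lam * c]mulrC opprD addrACA.
Qed.

Lemma twop_bar z lam F : (forall m, F m [::] = 0) ->
  twop z lam (bar F) = bar (twop z lam F).
Proof.
move=> F0; apply/funext => m; apply/funext => -[|c [|a l]] //.
  by rewrite /= !F0 scaler0 subrr.
rewrite bar2; pose G : X := fun m' s => pre c F (m' * z) s.
rewrite -[pre c (twop _ _ _)]/(pre (z * c) F - lam *: G).
rewrite barB barZ -[twop _ _ (bar F) _ _]/(bar F m [:: z * c, a & l]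
  - lam *: bar F (m * z) [:: c, a & l]) !bar2.
rewrite !appE -[twop _ _ F _ _]/(F m (z * (c * a) :: l) - lam *: F (m * z) (c * a :: l)).
have -> : bar G m (a :: l) = bar (pre c F) (m * z) (a :: l) by exact: bar_mulr.
rewrite mulrA scalerBr !opprB [LHS]addrACA [RHS]addrACA; congr (_ + _).
exact: addrC.
Qed.

Lemma mlin_pre a F : mlin F -> mlin (pre a F).
Proof.
by move=> [Fm Fl]; split=> [l|m l1 l2]; [exact: Fm | exact: (Fl m (a :: l1))].
Qed.

Lemma mlin_lin c F G : mlin F -> mlin G -> mlin (c *: F + G).
Proof.
have lin f g : linear f -> linear g -> linear (fun x : A => c *: f x + g x : V).
  move=> lf lg d x y; rewrite lf lg !scalerDr !scalerA [c * d]mulrC addrACA.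
  by [].
by move=> [Fm Fl] [Gm Gl]; split=> [l|m l1 l2]; apply: lin.
Qed.

Lemma mlin0 : mlin 0.
Proof. by split=> *; move=> ? ? ?; rewrite /= scaler0 addr0. Qed.

Lemma bar_mlin F : mlin F -> mlin (bar F).
Proof.
have lin f g : linear f -> linear g -> linear (fun x : A => f x - g x : V).
  by move=> lf lg d x y; rewrite lf lg scalerBr opprD addrACA.
move=> mF; split=> [l|m l1 l2].
  case: l => [|a l]; first by move=> ? ? ?; rewrite /= scaler0 addr0.
  elim: l F mF a => [|a' l IH] F mF a.
    by move=> c x y; rewrite !bar1 mulrDr -scalerAr mF.1.
  have h := IH _ (mlin_pre a mF) a'.
  by apply: (lin _ (fun x => bar (pre a F) x (a' :: l))) => //; apply: mF.1.
have head G m' a' l : mlin G -> linear (fun x => bar G m' (x :: l)).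
  elim: l G => [|b l IH] G mG c x y.
    by rewrite !bar1 mulrDl -scalerAl mG.1.
  rewrite !bar2 mulrDl -scalerAl (mG.2 _ [::]) ![[::] ++ _]/=.
  have -> : pre (c *: x + y) G = c *: pre x G + pre y G.
    by apply/funext => m1; apply/funext => l1'; exact: (mG.2 m1 [::]).
  by rewrite bar_lin !appE scalerBr opprD addrACA.
elim: l1 F mF m => [|a [|a' l1] IH] F mF m; first exact: head.
  apply: (lin (fun x => F m (a * x :: l2)) (fun x => bar (pre a F) m (x :: l2))).
    by move=> c x y; rewrite mulrDr -scalerAr (mF.2 _ [::]).
  exact: (IH _ (mlin_pre a mF)).
apply: (lin (fun x => F m (a * a' :: l1 ++ x :: l2))
   (fun x => bar (pre a F) m (a' :: l1 ++ x :: l2))).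
  exact: (mF.2 _ (a * a' :: l1)).
exact: (IH _ (mlin_pre a mF)).
Qed.

Lemma twop_mlin z lam F : mlin F -> mlin (twop z lam F).
Proof.
have lin f g : linear f -> linear g -> linear (fun x : A => f x - lam *: g x : V).
  move=> lf lg d x y; rewrite lf lg scalerBr scalerDr !scalerA [lam * d]mulrC.
  by rewrite opprD addrACA.
move=> mF; split=> [[|c l]|m [|c l1] l2].
- by move=> ? ? ?; rewrite /= scaler0 addr0.
- apply: (lin (fun x => F x (z * c :: l)) (fun x => F (x * z) (c :: l))).
    exact: mF.1.
  by move=> d x y; rewrite mulrDl -scalerAl mF.1.
- apply: (lin (fun x => F m (z * x :: l2)) (fun x => F (m * z) (x :: l2))).
    by move=> d x y; rewrite mulrDr -scalerAr (mF.2 _ [::]).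
  exact: (mF.2 _ [::]).
apply: (lin (fun x => F m (z * c :: l1 ++ x :: l2)) (fun x => F (m * z) (c :: l1 ++ x :: l2))).
  exact: (mF.2 _ (z * c :: l1)).
exact: (mF.2 _ (c :: l1)).
Qed.

End BarCochains.

(** * Words in a colour Weyl algebra *)

(** Generators and relations of a Weyl algebra whose commutators are twisted by a
    bicharacter of the grading group U. The generators come in dual pairs i,
    star i of opposite degrees; chi i u is the scalar picked up when gen i moves
    across an element of degree u. The last field gives, for each nonzero degree
    u, an element whose commutator acts on each degree by an additive scalar om
    that does not vanish on u. *)
Record color_weyl (k : fieldType) (A : algType k) (U : zmodType) (M : nat) :=
  ColorWeyl {
    gen :> 'I_M -> A;
    star : 'I_M -> 'I_M;
    wt : 'I_M -> U;
    chi : 'I_M -> U -> k;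
    eps : 'I_M -> k;
    starK : involutive star;
    wt_star : forall i, wt (star i) = - wt i;
    wt_sum : \sum_i wt i = 0;
    chi_neq0 : forall i u, chi i u != 0;
    chiD : forall i u v, chi i (u + v) = chi i u * chi i v;
    chi_self : forall i, chi i (wt i) = 1;
    chi_anti : forall i j, chi i (wt j) * chi j (wt i) = 1;
    chi_star : forall i u, chi (star i) u * chi i u = 1;
    eps_neq0 : forall i, eps i != 0;
    gen_comm : forall i j, gen i * gen j =
      chi i (wt j) *: (gen j * gen i) + (if j == star i then eps i else 0)%:A;
    gen_span : forall a, lspan (fun b => exists w, b = \prod_(i <- w) gen i) a;
    gen_euler : forall u, u != 0 -> exists h (om : U -> k),
      [/\ forall v w, om (v + w) = om v + om w, om u != 0 &
          forall j, h * gen j - gen j * h = om (wt j) *: gen j] }.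

Section Linearity.
Variables (k : fieldType) (V W : lmodType k) (f : V -> W).
Hypothesis lf : linear f.

Lemma lin0 : f 0 = 0.
Proof. by have := lf (-1) 0 0; rewrite scaler0 addr0 scaleN1r addNr. Qed.
Lemma linZ c x : f (c *: x) = c *: f x.
Proof. by rewrite -[c *: x]addr0 lf lin0 addr0. Qed.
Lemma linD x y : f (x + y) = f x + f y.
Proof. by rewrite -[x]scale1r lf !scale1r. Qed.
Lemma linB x y : f (x - y) = f x - f y.
Proof. by rewrite addrC -scaleN1r lf scaleN1r addrC. Qed.

End Linearity.

Lemma lspan_map (k : fieldType) (V W : lmodType k) (f : V -> W) S T v :
  linear f -> (forall x, S x -> lspan T (f x)) -> lspan S v -> lspan T (f v).
Proof.
move=> lf ST; elim=> [x /ST //||c x y _ Tx _ Ty].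
  by rewrite lin0 //; exact: lspan_0.
by rewrite lf; apply: lspan_ZD.
Qed.

Lemma lspan_eq0 (k : fieldType) (V W : lmodType k) (f : V -> W) S v :
  linear f -> (forall x, S x -> f x = 0) -> lspan S v -> f v = 0.
Proof.
move=> lf S0; elim=> [x /S0 //||c x y _ fx _ fy].
  exact: lin0.
by rewrite lf fx fy scaler0 addr0.
Qed.

(** Words in the generators; ordered words give the Poincare-Birkhoff-Witt basis. *)
Section Words.
Variables (k : fieldType) (A : algType k) (U : zmodType) (M : nat).
Variable z : color_weyl A U M.
Local Notation word := (seq 'I_M).
Local Notation star := (star z).
Local Notation wt := (wt z).
Local Notation chi := (chi z).
Local Notation eps := (eps z).
Implicit Types (w v : word) (i j l : 'I_M) (u : U).

Definition mon w : A := \prod_(i <- w) z i.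
Definition wtw w : U := \sum_(i <- w) wt i.
Definition lei : rel 'I_M := fun i j => (i <= j)%N.
Definition ordered w := sorted lei w.

Lemma mon0 : mon [::] = 1. Proof. exact: big_nil. Qed.
Lemma mon_cons i w : mon (i :: w) = z i * mon w. Proof. exact: big_cons. Qed.
Lemma mon_cat w v : mon (w ++ v) = mon w * mon v. Proof. exact: big_cat. Qed.
Lemma mon1 i : mon [:: i] = z i. Proof. exact: big_seq1. Qed.
Lemma wtw0 : wtw [::] = 0. Proof. exact: big_nil. Qed.
Lemma wtw_cons i w : wtw (i :: w) = wt i + wtw w. Proof. exact: big_cons. Qed.
Lemma wtw_cat w v : wtw (w ++ v) = wtw w + wtw v. Proof. exact: big_cat. Qed.
Lemma wtw1 i : wtw [:: i] = wt i. Proof. exact: big_seq1. Qed.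
Lemma wtw_perm w v : perm_eq w v -> wtw w = wtw v.
Proof. exact: perm_big. Qed.

Lemma chi0 i : chi i 0 = 1.
Proof. by apply: (mulfI (chi_neq0 z i 0)); rewrite -chiD addr0 mulr1. Qed.
Lemma chi_starr i : chi i (wt (star i)) = 1.
Proof.
by have := chiD z i (wt i) (wt (star i)); rewrite wt_star subrr chi0 chi_self mul1r.
Qed.

Lemma lei_trans : transitive lei. Proof. by move=> ? ? ?; apply: leq_trans. Qed.
Lemma lei_total : total lei. Proof. by move=> ? ?; apply: leq_total. Qed.
Lemma lei_anti : antisymmetric lei.
Proof. by move=> i j h; apply: ord_inj; apply: anti_leq. Qed.

Lemma ordered_cons i w : ordered (i :: w) = all (lei i) w && ordered w.
Proof. by rewrite /ordered /= path_sortedE //; exact: lei_trans. Qed.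

Definition ins i w := sort lei (i :: w).
Lemma ins_ordered i w : ordered (ins i w).
Proof. exact: (sort_sorted lei_total). Qed.
Lemma perm_ins i w : perm_eq (ins i w) (i :: w). Proof. exact: permEl (perm_sort _ _). Qed.
Lemma ordered_eq w v : ordered w -> ordered v -> perm_eq w v -> w = v.
Proof. by apply: sorted_eq; [exact: lei_trans | exact: lei_anti]. Qed.
Lemma rem_ordered i w : ordered w -> ordered (rem i w).
Proof. exact: (subseq_sorted lei_trans (rem_subseq i w)). Qed.
Lemma mem_ins i w : i \in ins i w.
Proof. by rewrite (perm_mem (perm_ins i w)) mem_head. Qed.
Lemma rem_ins i w : ordered w -> rem i (ins i w) = w.
Proof.
move=> ow; apply: ordered_eq => //; first exact: rem_ordered (ins_ordered i w).
rewrite -(perm_cons i); apply: perm_trans (perm_ins i w).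
by rewrite perm_sym; apply: perm_to_rem; exact: mem_ins.
Qed.
Lemma ins_rem i w : ordered w -> i \in w -> ins i (rem i w) = w.
Proof.
move=> ow iw; apply: ordered_eq => //; first exact: ins_ordered.
by apply: perm_trans (perm_ins _ _) _; rewrite perm_sym; apply: perm_to_rem.
Qed.
Lemma ins_min i w : ordered (i :: w) -> ins i w = i :: w.
Proof. by move=> o; apply: ordered_eq (ins_ordered _ _) o (perm_ins _ _). Qed.
Lemma wtw_ins i w : wtw (ins i w) = wt i + wtw w.
Proof. by rewrite (wtw_perm (perm_ins i w)) wtw_cons. Qed.

Definition omons (j : nat) u (a : A) := exists w,
  [/\ ordered w, all (fun l : 'I_M => j <= l)%N w, wtw w = u & a = mon w].

(** Straightening, with control of the weight and of the smallest letter. The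
    bound j survives because the commutation rule only moves letters or cancels
    a dual pair; the construction of antiderivatives depends on it. *)
Lemma omons_gen (j : nat) i w : ordered w ->
  all (fun l : 'I_M => j <= l)%N w -> (j <= i)%N ->
  lspan (omons j (wt i + wtw w)) (z i * mon w).
Proof.
elim: w j i => [|j' w IH] j i; rewrite ?ordered_cons.
  by move=> _ _ ji; apply: lspan_gen; exists [:: i]; rewrite mon_cons wtw_cons /= ji.
move=> /andP[j'w ow] /= /andP[jj' jw] ji.
have [ij'|j'i] := leqP i j'.
  apply: lspan_gen; exists (i :: j' :: w); rewrite !mon_cons !wtw_cons.
  rewrite !ordered_cons j'w ow /= ji jj' jw /lei ij' /= andbT; split=> //.
  by apply: sub_all j'w => l; apply: leq_trans.
rewrite mon_cons mulrA gen_comm mulrDl -scalerAl -mulrA; apply: lspan_ZD.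
  apply: (lspan_map (f := fun a => z j' * a)) (IH j' i ow j'w (ltnW j'i)).
    by move=> c a b; rewrite mulrDr -scalerAr.
  move=> _ [v [ov jv wv ->]]; apply: lspan_gen; exists (j' :: v).
  rewrite ordered_cons ov mon_cons !wtw_cons wv addrCA /= jj' andbT; split=> //.
  by apply: sub_all jv => l; apply: leq_trans.
rewrite -scalerAl mul1r; case: eqP => [->|_]; last by rewrite scale0r; exact: lspan_0.
rewrite wtw_cons wt_star addrA subrr add0r -[_ *: _]addr0.
by apply: lspan_ZD (lspan_0 _); apply: lspan_gen; exists w.
Qed.

Lemma omons_mon w : lspan (omons 0 (wtw w)) (mon w).
Proof.
elim: w => [|i w IH]; first by apply: lspan_gen; exists [::].
rewrite mon_cons; apply: (lspan_map (f := fun a => z i * a)) IH.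
  by move=> c a b; rewrite mulrDr -scalerAr.
move=> _ [v [ov jv wv ->]]; rewrite wtw_cons -wv; exact: omons_gen.
Qed.

Lemma ordered_span a : lspan (fun b => exists2 w, ordered w & b = mon w) a.
Proof.
apply: (lspan_map (f := id)) (gen_span z a) => // _ [w ->].
apply: (lspan_map (f := id)) (omons_mon w) => // _ [v [ov _ _ ->]].
by apply: lspan_gen; exists v.
Qed.

(** On elements of degree u the twisted commutator with z i is, up to nonzero
    scalars, the partial derivative along the letter star i (dtw_mon). *)
Definition dtw i u (a : A) := z i * a - chi i u *: (a * z i).

(** The scalar of this derivative on an ordered word: up to a unit, the
    multiplicity of star i. *)
Fixpoint kap i w : k := if w is l :: w' then
    if l == star i then eps i *+ (count_mem (star i) w').+1
    else chi i (wt l) * kap i w'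
  else 0.

Lemma dtw_linear i u : linear (dtw i u).
Proof.
move=> c a b; rewrite /dtw mulrDr mulrDl -scalerAr -scalerAl scalerDr scalerBr.
by rewrite !scalerA [c * _]mulrC opprD addrACA.
Qed.

Lemma dtw_cons i l w : dtw i (wtw (l :: w)) (mon (l :: w)) =
  chi i (wt l) *: (z l * dtw i (wtw w) (mon w))
  + (if l == star i then eps i else 0) *: mon w.
Proof.
rewrite /dtw wtw_cons chiD !mon_cons mulrA gen_comm mulrDl -!scalerAl mul1r.
by rewrite mulrBr scalerBr -scalerAr !scalerA !mulrA addrAC.
Qed.

Lemma kap_notin i w : star i \notin w -> kap i w = 0.
Proof.
elim: w => //= l w IH; rewrite inE negb_or eq_sym => /andP[/negbTE-> /IH->].
exact: mulr0.
Qed.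

Lemma dtw_mon i w : ordered w ->
  dtw i (wtw w) (mon w) = kap i w *: mon (rem (star i) w).
Proof.
elim: w => [_|l w IH].
  by rewrite /dtw wtw0 mon0 chi0 mulr1 mul1r scale1r subrr scale0r.
rewrite ordered_cons => /andP[lw ow]; rewrite dtw_cons IH //=.
case: eqP => [e|_]; last by rewrite scale0r addr0 -scalerAr scalerA mon_cons.
rewrite {1}e chi_starr scale1r mulrS scalerDl addrC; congr (_ + _).
rewrite -scalerAr.
have [iw|iw] := boolP (star i \in w); last first.
  by rewrite (kap_notin iw) (count_memPn iw) !scale0r.
case: w lw ow iw {IH} => // l' w /andP[ll' _].
rewrite ordered_cons => /andP[l'w _] iw.
have e' : l' = star i.
  move: iw; rewrite inE => /orP[/eqP//|/(allP l'w) l'i].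
  by apply: lei_anti; rewrite l'i -e.
by rewrite /= e' eqxx mon_cons e add1n.
Qed.

Lemma comm_mon (h : A) (om : U -> k) : (forall u u', om (u + u') = om u + om u') ->
    (forall j, h * z j - z j * h = om (wt j) *: z j) ->
  forall w, h * mon w - mon w * h = om (wtw w) *: mon w.
Proof.
move=> omD hz; have om0 : om 0 = 0 by apply: (addrI (om 0)); rewrite -omD !addr0.
elim=> [|l w IH]; first by rewrite mon0 wtw0 om0 scale0r mulr1 mul1r subrr.
rewrite mon_cons wtw_cons omD scalerDl scalerAl -hz scalerAr -IH.
by rewrite mulrBl mulrBr !mulrA addrA subrK.
Qed.

Hypothesis char0 : [pchar k] =i pred0.

Lemma kap_neq0 i w : star i \in w -> kap i w != 0.
Proof.
elim: w => //= l w IH; rewrite inE eq_sym; case: eqP => [_ _|_] /=.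
  by rewrite -mulr_natr mulf_neq0 ?eps_neq0 //; move/pcharf0P: char0 => ->.
by move/IH => h; rewrite mulf_neq0 ?chi_neq0.
Qed.

End Words.

(** * The Poincare-Birkhoff-Witt basis *)

(** The ordered monomials are linearly independent. In one degree, applying the
    derivations dtw along the letters of a longest word of a relation kills all
    other words and leaves a nonzero multiple of 1; different degrees are told
    apart by the commutators of gen_euler. *)
Section Coordinates.
Variables (k : fieldType) (A : algType k) (U : zmodType) (M : nat).
Variable z : color_weyl A U M.
Hypothesis char0 : [pchar k] =i pred0.
Local Notation word := (seq 'I_M).
Local Notation mon := (mon z).
Local Notation wtw := (wtw z).
Implicit Types (w v : word) (i j l : 'I_M) (u : U).

Let lin_sum (f : A -> A) (s : seq word) c : linear f ->
  f (\sum_(w <- s) c w *: mon w) = \sum_(w <- s) c w *: f (mon w).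
Proof.
move=> lf; elim: s => [|w s IH].
  by rewrite !big_nil; rewrite (lin0 lf).
by rewrite !big_cons lf IH.
Qed.

Lemma indep_top w0 (s : seq word) (c : word -> k) u : uniq s -> w0 \in s ->
    {in s, forall w, [/\ ordered w, wtw w = u & (size w <= size w0)%N]} ->
  \sum_(w <- s) c w *: mon w = 0 -> c w0 = 0.
Proof.
elim: w0 s c u => [|l w0 IH] s c u us sw0 ws s0.
  move: s0; rewrite (bigD1_seq [::]) //= big_seq_cond big1 ?addr0.
    by move/eqP; rewrite mon0 scaler_eq0 oner_eq0 orbF => /eqP.
  by move=> w /andP[/ws[_ _]]; rewrite leqn0 size_eq0 => ->.
pose i := star z l; have il : star z i = l by exact: starK.
have ow0 : ordered (l :: w0) by have [] := ws _ sw0.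
pose s1 := [seq w <- s | l \in w].
pose c' v := c (ins l v) * kap z i (ins l v).
have s1P w : w \in s1 -> [/\ w \in s, l \in w, ordered w & ins l (rem l w) = w].
  rewrite mem_filter => /andP[lw sw]; have [ow _ _] := ws _ sw.
  by rewrite ins_rem.
have l1 : l :: w0 \in s1 by rewrite mem_filter mem_head.
have e0 : rem l (l :: w0) = w0 by rewrite /= eqxx.
have c0 : c' w0 = 0.
  apply: (IH [seq rem l w | w <- s1] _ (u - wt z l)).
  - rewrite map_inj_in_uniq ?filter_uniq //.
    by move=> w v /s1P[_ _ _ ew] /s1P[_ _ _ ev] e; rewrite -ew -ev e.
  - by rewrite -e0; apply: map_f.
  - move=> _ /mapP[w /s1P[sw lw ow _] ->]; have [_ ww zw] := ws _ sw.
    split; first exact: rem_ordered.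
      by rewrite -ww (wtw_perm z (perm_to_rem lw)) wtw_cons addrC addKr.
    by rewrite size_rem // -ltnS prednK //; case: (w) lw.
  rewrite big_map.
  transitivity (\sum_(w <- s) c w *: dtw z i u (mon w)); last first.
    rewrite -(lin_sum _ _ (dtw_linear z i u)) s0.
    by rewrite /dtw mulr0 mul0r scaler0 subrr.
  rewrite big_filter big_mkcond big_seq [RHS]big_seq; apply: eq_bigr => w sw.
  have [ow <- _] := ws _ sw; rewrite dtw_mon // il scalerA.
  case: ifPn => lw; first by rewrite /c' ins_rem.
  by rewrite kap_notin ?il // mulr0 scale0r.
have e1 : ins l w0 = l :: w0 by rewrite ins_min.
move/eqP: c0; rewrite /c' e1 mulf_eq0 (negbTE (kap_neq0 _ _)) ?orbF ?il ?mem_head //.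
by move/eqP.
Qed.

Let longest (s : seq word) w : w \in s ->
  exists2 w', w' \in s & {in s, forall v, (size v <= size w')%N}.
Proof.
elim: s w => // a [|b s] IH w _.
  by exists a; rewrite ?mem_head // => v; rewrite inE => /eqP->.
have [w' sw' h] := IH b (mem_head _ _).
have [le|lt] := leqP (size a) (size w').
  by exists w'; rewrite 1?inE ?sw' ?orbT // => v; rewrite inE => /orP[/eqP->|/h].
exists a; rewrite ?mem_head // => v; rewrite inE => /orP[/eqP->//|/h le].
exact: leq_trans le (ltnW lt).
Qed.

Lemma indep (s : seq word) (c : word -> k) : uniq s -> {in s, forall w, ordered w} ->
  \sum_(w <- s) c w *: mon w = 0 -> {in s, forall w, c w = 0}.
Proof.
move: {2}(size s) (leqnn (size s)) => n; elim: n s c => [|n IH] s c.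
  by rewrite leqn0 size_eq0 => /eqP->.
case: s => // w1 s; rewrite ltnS => sn us os s0.
have [sameP|] := boolP (all (fun w => wtw w == wtw w1) s).
  move=> w sw; apply/eqP/negPn/negP => cw.
  pose s' := [seq v <- w1 :: s | c v != 0].
  have s'P v : v \in s' -> c v != 0 /\ v \in w1 :: s.
    by rewrite mem_filter => /andP[].
  have [|w0 s'w0 w0max] := @longest s' w; first by rewrite mem_filter cw.
  have [/eqP h _] := s'P _ s'w0; apply: h.
  apply: (indep_top (s := s') (u := wtw w1)) => //; first exact: filter_uniq.
    move=> v s'v; have [_ sv] := s'P _ s'v; split; [exact: os | | exact: w0max].
    by move: sv; rewrite inE => /orP[/eqP->//|/(allP sameP)/eqP].
  rewrite big_filter -[RHS]s0 [RHS](bigID (fun v => c v == 0)) /=.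
  by rewrite [X in _ = X + _]big1 ?add0r // => v /eqP->; rewrite scale0r.
case/allPn=> w2 sw2 ne.
have [|h [om [omD om0 hz]]] := gen_euler z (u := wtw w2 - wtw w1).
  by rewrite subr_eq0.
have om_sub x y : om (x - y) = om x - om y by rewrite -[in RHS](subrK y x) omD addrK.
have hmon := comm_mon omD hz.
pose f a := h * a - a * h - om (wtw w1) *: a.
have lf : linear f.
  have twoB (x x' y y' : A) (d : k) :
      d *: x + x' - (d *: y + y') = d *: (x - y) + (x' - y').
    by rewrite scalerBr opprD addrACA.
  move=> d a b; rewrite /f mulrDr mulrDl -scalerAr -scalerAl scalerDr !scalerA.
  by rewrite [om _ * d]mulrC -scalerA !twoB.
have c2 : c w2 = 0.
  have : \sum_(w <- s) (c w * (om (wtw w) - om (wtw w1))) *: mon w = 0.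
    transitivity (f (\sum_(w <- w1 :: s) c w *: mon w)); last first.
      by rewrite s0 /f mulr0 mul0r scaler0 !subrr.
    rewrite lin_sum // big_cons {1}/f hmon subrr scaler0 add0r.
    by apply: eq_bigr => w _; rewrite /f hmon -scalerBl scalerA.
  move/IH => /(_ sn); case/andP: us => _ us /(_ us) h2.
  have /eqP : c w2 * (om (wtw w2) - om (wtw w1)) = 0.
    by apply: h2 => // w sw; apply: os; rewrite inE sw orbT.
  by rewrite mulf_eq0 -om_sub (negbTE om0) orbF => /eqP.
have sw2' : w2 \in w1 :: s by rewrite inE sw2 orbT.
have h2 : {in rem w2 (w1 :: s), forall w, c w = 0}.
  apply: IH.
  - by rewrite size_rem.
  - exact: rem_uniq.
  - by move=> w /mem_rem; apply: os.
  - rewrite -[RHS]s0 [RHS](perm_big _ (perm_to_rem sw2')) [RHS]big_cons /=.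
    by rewrite c2 scale0r add0r.
move=> w; rewrite (perm_mem (perm_to_rem sw2')) inE => /orP[/eqP->//|].
exact: h2.
Qed.

Definition ordered_supp (g : {malg k[word]}) := forall w, w \in msupp g -> ordered w.

Let supp_lin c g h : ordered_supp g -> ordered_supp h -> ordered_supp (c *: g + h).
Proof.
move=> og oh w wg; have := fsubsetP (msuppD_le (c *: g) h) w wg.
rewrite in_fsetU => /orP[|/oh//]; move/(fsubsetP (msuppZ_le c g)); exact: og.
Qed.

Lemma coord_exists a : exists g : {malg k[word]}, ordered_supp g /\ linext mon g = a.
Proof.
elim: (ordered_span z a) => [_ [w ow ->]||c _ _ _ [g [og <-]] _ [h [oh <-]]].
- exists << w >>; rewrite linextU; split=> // v.
  by move/(fsubsetP (msuppU_le)); rewrite in_fset1 => /eqP->.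
- by exists 0; rewrite linear0; split=> // w; rewrite msupp0.
- by exists (c *: g + h); rewrite linearP; split=> //; exact: supp_lin.
Qed.

Definition coord a : {malg k[word]} := sval (cid (coord_exists a)).

Lemma coord_ordered a : ordered_supp (coord a).
Proof. by rewrite /coord; case: cid => g []. Qed.
Lemma coordK a : linext mon (coord a) = a.
Proof. by rewrite /coord; case: cid => g []. Qed.

Lemma linext_inj g h : ordered_supp g -> ordered_supp h ->
  linext mon g = linext mon h -> g = h.
Proof.
move=> og oh e; apply/eqP; rewrite -subr_eq0; apply/eqP.
have od : ordered_supp (g - h) by rewrite addrC -scaleN1r; apply: supp_lin.
have d0 : linext mon (g - h) = 0 by rewrite linearB /= e subrr.
apply/malgP => w; rewrite mcoeff0.
have [wd|] := boolP (w \in msupp (g - h)); last exact: mcoeff_outdom.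
move: d0; rewrite linextE => d0.
exact: (indep (s := msupp (g - h)) (c := fun w => (g - h)@_w) (fset_uniq _) od d0).
Qed.

Lemma coord_linear : linear coord.
Proof.
move=> c a b; apply: linext_inj; first exact: coord_ordered.
  by apply: supp_lin; exact: coord_ordered.
by rewrite linearP /= !coordK.
Qed.

Lemma coord_mon w : ordered w -> coord (mon w) = << w >>.
Proof.
move=> ow; apply: linext_inj; first exact: coord_ordered.
  by move=> v /(fsubsetP (msuppU_le)); rewrite in_fset1 => /eqP->.
by rewrite coordK linextU.
Qed.

Section Extension.
Variable (V : lmodType k).

(** The linear map with prescribed values on the ordered monomials. *)
Definition ext (h : word -> V) (a : A) : V := linext h (coord a).

Lemma ext_linear h : linear (ext h).
Proof. by move=> c a b; rewrite /ext coord_linear linearP. Qed.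

Lemma ext_mon h w : ordered w -> ext h (mon w) = h w.
Proof. by move=> ow; rewrite /ext coord_mon // linextU. Qed.

Lemma ext_lin c h h' a :
  ext (fun w => c *: h w + h' w) a = c *: ext h a + ext h' a.
Proof.
rewrite /ext !linextE scaler_sumr -big_split; apply: eq_bigr => w _ /=.
by rewrite scalerDr !scalerA mulrC.
Qed.

Lemma ext_eq h h' a : (forall w, ordered w -> h w = h' w) -> ext h a = ext h' a.
Proof.
move=> e; rewrite /ext !linextE big_seq [RHS]big_seq; apply: eq_bigr => w wa.
by rewrite e //; apply: coord_ordered wa.
Qed.

End Extension.
End Coordinates.

(** * Twisted commutation operators *)

Section TwistedCochains.
Variables (k : fieldType) (A : algType k) (U : zmodType) (M : nat).
Variables (z : color_weyl A U M) (V : lmodType k).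
Local Notation word := (seq 'I_M).
Local Notation mon := (mon z).
Local Notation wtw := (wtw z).
Local Notation X := (A -> seq A -> V).
Implicit Types (w v : word) (i j : 'I_M) (u : U) (F G H t : X) (n p : nat).
Implicit Types (m a : A) (l s : seq A).

Definition supported u F := forall w (ws : seq word),
  wtw w + \sum_(v <- ws) wtw v != u -> F (mon w) (map mon ws) = 0.

Definition cochain n u F :=
  [/\ mlin F, forall m l, size l != n.+1 -> F m l = 0 & supported u F].

(** The scalar depends on the degree u of the cochains it acts on; in degree 0
    it is 1, and the cochains killed by all dop i are then the functions of
    m * c. *)
Definition dop i u F : X := twop (z i) (chi z i u) F.

Let addE F G m l : (F + G : X) m l = F m l + G m l. Proof. by []. Qed.
Let subE F G m l : (F - G : X) m l = F m l - G m l. Proof. by []. Qed.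
Let sclE (c : k) F m l : (c *: F : X) m l = c *: F m l. Proof. by []. Qed.

Lemma cochain0 n u : cochain n u 0.
Proof. by split=> //; exact: mlin0. Qed.

Lemma cochain_lin n u c F G : cochain n u F -> cochain n u G ->
  cochain n u (c *: F + G).
Proof.
move=> [mF zF sF] [mG zG sG]; split; first exact: mlin_lin.
  by move=> m l h; rewrite addE sclE zF // zG // scaler0 addr0.
by move=> w ws h; rewrite addE sclE sF // sG // scaler0 addr0.
Qed.

Lemma cochain_nil n u F m : cochain n u F -> F m [::] = 0.
Proof. by case=> _ zF _; apply: zF. Qed.

Lemma bar_size (P : nat -> bool) F : (forall m l, ~~ P (size l) -> F m l = 0) ->
  forall m l, ~~ P (size l).-1 -> bar F m l = 0.
Proof.
move=> zF m [|a l] //=; elim: l a P F zF => [|b l IH] a P F zF /= nP.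
  exact: zF.
rewrite zF //; rewrite (IH _ (fun n => P n.+1)) ?subrr // => m' l' nP'.
exact: zF.
Qed.

Lemma cochain_bar n u F : cochain n u F -> cochain n.+1 u (bar F).
Proof.
move=> [mF zF sF]; split; first exact: bar_mlin.
  move=> m [|a l] //; rewrite eqSS => ln.
  exact: (bar_size (P := fun x => x == n.+1)).
move=> w [|a ws] //= {mF zF}.
elim: ws a F u sF => [|b ws IH] a F u sF; rewrite !big_cons ?big_nil ?addr0 => h /=.
  by rewrite -mon_cat (sF _ [::]) // big_nil addr0 wtw_cat addrC.
rewrite -mon_cat (sF w ((a ++ b) :: ws)) ?sub0r ?big_cons ?wtw_cat -?addrA //.
rewrite (IH b _ (u - wtw a)) ?oppr0 // => [w' ws' h'|].
  rewrite /pre (sF w' (a :: ws')) // big_cons; apply: contra h' => /eqP <-.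
  by rewrite [wtw a + _]addrC addrA addrK.
apply: contra h => /eqP; rewrite big_cons => e.
by rewrite addrCA e addrC subrK.
Qed.

Lemma cochain_dop n u i F : cochain n u F -> cochain n (u - wt z i) (dop i u F).
Proof.
move=> [mF zF sF]; split; first exact: twop_mlin.
  by move=> m [|a l] // h; rewrite /= !zF // scaler0 subrr.
move=> w [|a ws] //; rewrite big_cons /= => h.
rewrite -mon_cons (sF w ((i :: a) :: ws)); last first.
  rewrite big_cons wtw_cons; apply: contra h => /eqP <-.
  by rewrite -[wt z i + _ + _]addrA [X in _ == X - _]addrCA [wt z i + _]addrC addrK.
rewrite -mon1 -mon_cat (sF (w ++ [:: i]) (a :: ws)) ?scaler0 ?subrr //.
rewrite big_cons wtw_cat wtw1; apply: contra h => /eqP <-.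
by rewrite addrAC addrK.
Qed.

Let dop_calc (P Q R S T : V) (a b c c' d : k) : c * c' = 1 -> a * b * d = d ->
  c *: P + d *: Q - a *: R - (b * c) *: (S - a *: T)
  = c *: (P - b *: S - (a * c') *: (R - b *: (c *: T + d *: Q))).
Proof.
move=> cc abd.
have e : c * (a * c') = a by rewrite mulrCA cc mulr1.
have eW : a *: (b *: (c *: T + d *: Q)) = (b * c) *: (a *: T) + d *: Q.
  by rewrite !scalerDr !scalerA abd [a * b]mulrC mulrAC.
have eR W : c *: ((a * c') *: (R - W)) = a *: R - a *: W.
  by rewrite scalerA e scalerBr.
rewrite [RHS]scalerBr [c *: (P - _)]scalerBr eR eW [c *: (b *: _)]scalerA [c * b]mulrC.
rewrite [(b * c) *: (S - _)]scalerBr !opprB -!addrA; congr (_ + _).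
rewrite [RHS]addrC -!addrA [- (a *: R) + _ in LHS]addrCA [LHS]addrCA.
by [].
Qed.

(** The only term that could break commutation is the constant term of
    the relation between dual generators; it cancels because the scalars of
    a dual pair are inverse to each other. *)
Lemma dop_dop n u i j F : cochain n u F -> exists2 c, c != 0 &
  dop j (u - wt z i) (dop i u F) = c *: dop i (u - wt z j) (dop j u F).
Proof.
move=> [mF _ _]; exists (chi z i (wt z j)); first exact: chi_neq0.
have chiB x y y' : chi z x (y - y') = chi z x y * (chi z x y')^-1.
  by apply: (mulIf (chi_neq0 z x y')); rewrite -chiD subrK mulfVK ?chi_neq0.
have canti x y : (chi z x (wt z y))^-1 = chi z y (wt z x).
  by apply: (mulfI (chi_neq0 z x (wt z y))); rewrite chi_anti divff ?chi_neq0.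
pose d := if j == star z i then eps z i else 0.
have hd : chi z i u * chi z j u * d = d.
  by rewrite /d; case: eqP => [->|_]; rewrite ?mulr0 // [_ * chi _ _ _]mulrC chi_star mul1r.
apply/funext => m; apply/funext => -[|a l]; first by rewrite sclE /= scaler0.
rewrite sclE /dop /= !chiB !canti !mulrA gen_comm -/d.
have -> : F m ((chi z i (wt z j) *: (z j * z i) + d%:A) * a :: l) =
    chi z i (wt z j) *: F m (z j * z i * a :: l) + d *: F m (a :: l).
  by rewrite mulrDl -!scalerAl mul1r (mF.2 m [::]) /= (linZ (mF.2 m [::] l)).
have -> : F (m * z i * z j) (a :: l) =
    chi z i (wt z j) *: F (m * z j * z i) (a :: l) + d *: F m (a :: l).
  rewrite -mulrA gen_comm -/d mulrDr -!scalerAr mulr1 (mF.1 (a :: l)) mulrA.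
  by rewrite (linZ (mF.1 (a :: l))).
apply: dop_calc => //.
by rewrite chi_anti.
Qed.
End TwistedCochains.

(** * Exactness and regularity *)

Section Regularity.
Variables (k : fieldType) (A : algType k) (U : zmodType) (M : nat).
Variables (z : color_weyl A U M) (V : lmodType k).
Hypothesis char0 : [pchar k] =i pred0.
Local Notation word := (seq 'I_M).
Local Notation mon := (mon z).
Local Notation wtw := (wtw z).
Local Notation X := (A -> seq A -> V).
Local Notation cochain := (@cochain k A U M z V).
Local Notation dop := (@dop k A U M z V).
Local Notation ext := (@ext k A U M z V).
Implicit Types (w v : word) (i j : 'I_M) (u : U) (F G H t : X) (n : nat) (p : 'I_M).
Implicit Types (m a : A) (l s : seq A).

Let addE F G m l : (F + G : X) m l = F m l + G m l. Proof. by []. Qed.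
Let subE F G m l : (F - G : X) m l = F m l - G m l. Proof. by []. Qed.
Let sclE (c : k) F m l : (c *: F : X) m l = c *: F m l. Proof. by []. Qed.

Let dopE2 i j u u' F m a s : dop j u' (dop i u F) m (a :: s) =
  dop i u F m (z j * a :: s) - chi z j u' *: dop i u F (m * z j) (a :: s).
Proof. by []. Qed.

Lemma cochain_acyclic n u F : cochain n.+1 u F -> bar F = 0 ->
  exists2 G, cochain n u G & bar G = F.
Proof.
move=> CF bF; have [mF zF sF] := CF; exists (pre 1 F); last first.
  by apply: bar_pre1 => // m; apply: cochain_nil CF.
split; first exact: mlin_pre.
  by move=> m l h; apply: zF; rewrite eqSS.
move=> w ws h; rewrite /pre -(mon0 z) (sF w ([::] :: ws)) //.
by rewrite big_cons wtw0 add0r.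
Qed.

(** The equations dop i G = 0 for i < p and dop p G = H determine G on an
    ordered word in the place c from its value on the word without its first
    letter, as long as this letter is at most p; on the other words G may be
    taken to be 0. *)
Fixpoint antideriv (p : 'I_M) u H w m s : V := match w with
  | [::] => 0
  | i :: w' =>
      if (i < p)%N then chi z i u *: antideriv p u H w' (m * z i) s
      else if i == p then
        chi z i u *: antideriv p u H w' (m * z i) s + H m (mon w' :: s)
      else 0
  end.

Let sol (p : 'I_M) u H : X := fun m l =>
  if l is a :: s then ext (fun w => antideriv p u H w m s) a else 0.

Let solE p u H w m s : ordered w ->
  sol p u H m (mon w :: s) = antideriv p u H w m s.
Proof. by move=> ow; rewrite /sol ext_mon. Qed.

Let comb (f g : A -> V) c : linear f -> linear g ->
  linear (fun x => c *: f x + g x).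
Proof.
move=> lf lg d x y; rewrite lf lg !scalerDr !scalerA [c * d]mulrC addrACA.
by [].
Qed.

Let antideriv_linl p u H w s : mlin H -> linear (fun m => antideriv p u H w m s).
Proof.
move=> mH; have lin00 : linear (fun=> 0 : V) by move=> ? ? ?; rewrite scaler0 addr0.
elim: w => [|i w IH] //=.
have IHi : linear (fun m => antideriv p u H w (m * z i) s).
  by move=> c x y; rewrite mulrDl -scalerAl IH.
case: (i < p)%N; first by move=> c x y; rewrite IHi scalerDr !scalerA [_ * c]mulrC.
by case: (i == p) => //; apply: comb => //; apply: mH.1.
Qed.

Let antideriv_linr p u H w m l1 l2 : mlin H ->
  linear (fun x => antideriv p u H w m (l1 ++ x :: l2)).
Proof.
move=> mH; have lin00 : linear (fun=> 0 : V) by move=> ? ? ?; rewrite scaler0 addr0.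
elim: w m => [|i w IH] m //=.
case: (i < p)%N; first by move=> c x y; rewrite IH scalerDr !scalerA [_ * c]mulrC.
by case: (i == p) => //; apply: comb => //; exact: (mH.2 m (mon w :: l1)).
Qed.

Let sol_mlin p u H : mlin H -> mlin (sol p u H).
Proof.
move=> mH; split=> [[|a s]|m [|a l1] l2] c x y; rewrite /sol /=.
- by rewrite scaler0 addr0.
- by rewrite -ext_lin; apply: ext_eq => w _; apply: antideriv_linl.
- exact: (ext_linear z char0).
- by rewrite -ext_lin; apply: ext_eq => w _; apply: antideriv_linr.
Qed.

Let sol_cochain n p u H : cochain n (u - wt z p) H -> cochain n u (sol p u H).
Proof.
move=> [mH zH sH]; split; first exact: sol_mlin.
  move=> m [|a s] //; rewrite eqSS => hs; rewrite /sol.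
  transitivity (ext (fun=> 0) a); last first.
    by rewrite /ext linextE big1 // => w _; rewrite scaler0.
  apply: ext_eq => w _; elim: w m => //= i w IH m; rewrite IH scaler0 zH ?addr0 //.
  by case: (i < p)%N; case: (i == p).
move=> w [|v ws] //; rewrite big_cons => h.
suff hs : forall v', ordered v' -> wtw v' = wtw v ->
    sol p u H (mon w) (mon v' :: map mon ws) = 0.
  apply: (lspan_eq0 (f := fun x => sol p u H (mon w) (x :: map mon ws)) _ _ (omons_mon z v)).
    exact: ((sol_mlin p u mH).2 _ [::]).
  by move=> _ [v' [ov' _ wv' ->]]; exact: hs.
move=> v' ov' e; rewrite solE //; rewrite -{v}e in h.
elim: v' w h {ov'} => //= i v' IH w h.
have h' : antideriv p u H v' (mon w * z i) (map mon ws) = 0.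
  rewrite -mon1 -mon_cat; apply: IH; apply: contra h => /eqP <-.
  by rewrite wtw_cat wtw1 wtw_cons !addrA.
rewrite h' scaler0 add0r; case: ifP => // _; case: eqP => // e.
apply: (sH w (v' :: ws)); apply: contra h => /eqP; rewrite big_cons wtw_cons e.
by rewrite -[_ + _ + \sum_(_ <- _) _]addrA [_ + (wt z p + _)]addrCA => ->; rewrite addrC subrK.
Qed.

(** By construction the equations hold on words that stay ordered when the letter
    i is put in front. For the other words j :: w the letter j is smaller than
    i, and commuting dop i past dop j reduces the equation to the shorter w. *)
Let dop_sol n p u H : cochain n (u - wt z p) H ->
    (forall i, (i < p)%N -> dop i (u - wt z p) H = 0) ->
  forall w, ordered w -> forall i m s, (i <= p)%N ->
  dop i u (sol p u H) m (mon w :: s) = (if i == p then H m (mon w :: s) else 0).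
Proof.
move=> CH sH w; have CG := sol_cochain CH; have [mH _ _] := CH.
have direct i v m s : (i <= p)%N -> ordered (i :: v) ->
    dop i u (sol p u H) m (mon v :: s) = (if i == p then H m (mon v :: s) else 0).
  move=> ip oiv; have ov : ordered v by move: oiv; rewrite ordered_cons => /andP[].
  rewrite /dop /twop -mon_cons !solE //=.
  have [->|ne] := eqVneq i p; first by rewrite ltnn addrAC subrr add0r.
  rewrite ifT ?subrr // ltn_neqAle ip andbT.
  by apply: contra ne => /eqP/ord_inj->.
elim: w => [|j w IH] ow i m s ip; first exact: direct.
have [oi|] := boolP (ordered (i :: j :: w)); first exact: direct.
rewrite (ordered_cons i) ow andbT -[all _ _]/(lei i j && all (lei i) w) => h.
move: (ow); rewrite ordered_cons => /andP[jw ow'].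
have ji : (j < i)%N.
  rewrite ltnNge; apply: contra h => ij; apply/andP; split=> //.
  by apply: sub_all jw => l; apply: leq_trans.
have jp : (j < p)%N := leq_trans ji ip.
have jnp : (j == p) = false by apply/negP => /eqP e; rewrite e ltnn in jp.
have E0 v m' s' : ordered v -> all (fun l : 'I_M => j <= l)%N v ->
    dop j u (sol p u H) m' (mon v :: s') = 0.
  move=> ov jv; rewrite direct ?jnp ?(ltnW jp) //.
  by rewrite ordered_cons ov andbT.
have mE : mlin (dop j u (sol p u H)) by case: (cochain_dop j CG).
have [c _ DD] := dop_dop i j CG.
have := congr1 (fun f : X => f m (mon w :: s)) DD.
rewrite sclE !dopE2.
rewrite (lspan_eq0 (f := fun x => dop j u (sol p u H) m (x :: s)) _ _
  (omons_gen z ow' jw (ltnW ji))); first last.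
- by move=> _ [v [ov jv _ ->]]; exact: E0.
- exact: (mE.2 _ [::]).
rewrite E0 // scaler0 subrr scaler0 -mon_cons => /eqP.
rewrite subr_eq0 => /eqP->; rewrite IH //.
case: eqP => [e|]; last by rewrite scaler0.
have := congr1 (fun f : X => f m (mon w :: s)) (sH _ jp).
by rewrite /dop /twop -mon_cons e => /eqP; rewrite subr_eq0 => /eqP->.
Qed.

Lemma dop_onto n u (p : 'I_M) H : cochain n (u - wt z p) H ->
    (forall i, (i < p)%N -> dop i (u - wt z p) H = 0) ->
  exists G, [/\ cochain n u G, forall i, (i < p)%N -> dop i u G = 0
               & dop p u G = H].
Proof.
move=> CH sH; exists (sol p u H); have CG := sol_cochain CH.
have E i m l : (i <= p)%N ->
    dop i u (sol p u H) m l = (if i == p then H m l else 0).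
  case: l => [|a l] ip.
    by rewrite (cochain_nil _ CH) /dop /=; case: (i == p).
  have [mE _ _] := cochain_dop i CG; have [mH _ _] := CH.
  pose f x := dop i u (sol p u H) m (x :: l) - (if i == p then H m (x :: l) else 0).
  have /eqP : f a = 0; last by rewrite subr_eq0 => /eqP.
  apply: (lspan_eq0 (f := f)) (ordered_span z a).
    move=> c x y; rewrite /f (mE.2 _ [::]).
    case: (i == p); rewrite ?subr0 // (mH.2 _ [::]).
    by rewrite scalerBr opprD addrACA.
  by move=> _ [w ow ->]; rewrite /f (dop_sol CH sH) // subrr.
split=> // [i ip|].
  apply/funext => m; apply/funext => l; rewrite E ?(ltnW ip) //.
  by rewrite ifN //; apply/eqP => e; rewrite e ltnn in ip.
by apply/funext => m; apply/funext => l; rewrite E // eqxx.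
Qed.

(** Degree 0 cocycles are linear forms on A: t m [:: c] = t (c * m) [:: 1]
    (coc0E). On them dop i is the transpose of a partial derivative (coc0_dop),
    so the sum of the images of the first p operators consists of the forms
    that vanish on the elements killed by the first p derivatives, that is on
    the words without their dual letters. *)
Definition jideal (p : nat) t := forall w, ordered w ->
  all (fun l : 'I_M => p <= star z l)%N w -> t (mon w) [:: 1] = 0.

Lemma coc0E u t m c : cochain 0 u t -> bar t = 0 -> t m [:: c] = t (c * m) [:: 1].
Proof.
move=> Ct bt; have := congr1 (fun f : X => f m [:: 1; c]) bt.
by rewrite bar2 bar1 mul1r => /eqP; rewrite subr_eq0 => /eqP.
Qed.

Let coc0_lin u t : cochain 0 u t -> linear (fun a => t a [:: 1]).
Proof. by case=> mt _ _; apply: mt.1. Qed.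

Let coc0_wt u t w : cochain 0 u t -> wtw w != u -> t (mon w) [:: 1] = 0.
Proof.
move=> [_ _ st] h; have := st w [:: [::]]; rewrite big_seq1 wtw0 addr0 /= mon0.
exact.
Qed.

Let coc0_dop u t i w : cochain 0 u t -> bar t = 0 -> ordered w ->
  dop i u t (mon w) [:: 1] = kap z i w *: t (mon (rem (star z i) w)) [:: 1].
Proof.
move=> Ct bt ow; rewrite /dop /twop mulr1 (coc0E _ _ Ct bt).
have lt := coc0_lin Ct.
have [e|ne] := eqVneq (wtw w) (u - wt z i).
  rewrite -(linZ lt) -(linZ lt) -(linB lt) -dtw_mon //; congr (t _ _).
  have chiB : chi z i (u - wt z i) = chi z i u.
    by have := chiD z i (u - wt z i) (wt z i); rewrite subrK chi_self mulr1.
  by rewrite /dtw e chiB.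
have [iw|iw] := boolP (star z i \in w).
  have nw : wtw (rem (star z i) w) != u.
    apply: contra ne => /eqP <-.
    by rewrite (wtw_perm z (perm_to_rem iw)) wtw_cons wt_star addrC.
  rewrite (coc0_wt Ct nw) scaler0 -mon_cons -mon1 -mon_cat.
  by rewrite !(coc0_wt Ct) ?scaler0 ?subrr // ?wtw_cat ?wtw1 ?wtw_cons;
    apply: contra ne => /eqP <-; rewrite 1?[wt z i + _]addrC addrK.
rewrite kap_notin // scale0r -mon_cons -mon1 -mon_cat.
by rewrite !(coc0_wt Ct) ?scaler0 ?subrr // ?wtw_cat ?wtw1 ?wtw_cons;
    apply: contra ne => /eqP <-; rewrite 1?[wt z i + _]addrC addrK.
Qed.

Lemma jideal0 u t : cochain 0 u t -> bar t = 0 -> jideal 0 t -> t = 0.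
Proof.
move=> Ct bt jt; apply/funext => m; apply/funext => l.
have [_ zt _] := Ct; have [s1|] := eqVneq (size l) 1%N; last exact: zt.
case: l s1 => // c [] // _; rewrite (coc0E _ _ Ct bt).
apply: (lspan_eq0 (f := fun a => t a [:: 1])) (ordered_span z (c * m)).
  exact: coc0_lin Ct.
by move=> _ [w ow ->]; apply: jt => //; apply/allP.
Qed.

Lemma jidealD i u t : cochain 0 u t -> bar t = 0 -> jideal i.+1 (dop i u t).
Proof.
move=> Ct bt w ow aw; rewrite (coc0_dop _ Ct) // kap_notin ?scale0r //.
by apply/negP => /(allP aw); rewrite starK ltnn.
Qed.

(** Derivatives are onto: each ordered word is one, of the word with star i inserted. *)
Lemma jideal_inj i u t : cochain 0 u t -> bar t = 0 ->
  jideal i (dop i u t) -> jideal i t.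
Proof.
move=> Ct bt jt w ow aw.
have := jt _ (ins_ordered (star z i) w); rewrite (coc0_dop _ Ct) ?ins_ordered //.
rewrite rem_ins // (perm_all _ (perm_ins _ _)) /= starK leqnn aw.
by move/(_ isT)/eqP; rewrite scaler_eq0 (negbTE (kap_neq0 _ (mem_ins _ _))) // => /eqP.
Qed.

(** By coc0E all degree 0 cocycles are of this form. *)
Definition trace_coc (h : word -> V) : X :=
  fun m l => if l is [:: c] then ext h (c * m) else 0.

Lemma trace_cocP u (h : word -> V) :
    (forall w, ordered w -> wtw w != u -> h w = 0) ->
  cochain 0 u (trace_coc h) /\ bar (trace_coc h) = 0.
Proof.
move=> h0; have lh := ext_linear z char0 h.
have Ct0 : cochain 0 u (trace_coc h).
  split.
  - split=> [[|c [|? ?]]|m [|? [|? ?]] [|? ?]] d x y; rewrite /trace_coc /=;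
      rewrite ?scaler0 ?addr0 //.
      by rewrite mulrDr -scalerAr lh.
    by rewrite mulrDl -scalerAl lh.
  - by move=> m [|c [|? ?]].
  move=> w [|v [|? ?]] //; rewrite big_seq1 /= -mon_cat => ne.
  apply: (lspan_eq0 (f := ext h) lh) (omons_mon z (v ++ w)) => _ [w' [ow' _ ww' ->]].
  by rewrite (ext_mon z char0) // h0 // ww' wtw_cat addrC.
split=> //; apply/funext => m; apply/funext => l; have [_ zb _] := cochain_bar Ct0.
have [s2|] := eqVneq (size l) 2; last exact: zb.
by case: l s2 => // a [|b []] // _; rewrite bar2 bar1 /trace_coc /pre mulrA subrr.
Qed.

(** The form t0 is obtained by integrating along the letter star i. *)
Lemma jideal_onto i u t : cochain 0 (u - wt z i) t -> bar t = 0 -> jideal i.+1 t ->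
  exists2 t0, cochain 0 u t0 /\ bar t0 = 0 & jideal i (t - dop i u t0).
Proof.
move=> Ct bt jt; pose si := star z i.
pose h w := (kap z i (ins si w))^-1 *: t (mon (ins si w)) [:: 1].
have [|Ct0 bt0] := trace_cocP (u := u) (h := h).
  move=> w _ ww; rewrite /h (coc0_wt Ct) ?scaler0 // wtw_ins wt_star.
  by apply: contra ww => /eqP; rewrite addrC => /addIr ->.
exists (trace_coc h) => // w ow aw; rewrite subE (coc0_dop _ Ct0) //.
have [iw|iw] := boolP (si \in w).
  rewrite /trace_coc mul1r (ext_mon z char0) ?rem_ordered // /h ins_rem //.
  by rewrite scalerA divff ?scale1r ?subrr // kap_neq0.
rewrite kap_notin // scale0r subr0; apply: jt => //.
apply/allP => l lw; rewrite ltn_neqAle (allP aw) // andbT.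
by apply: contra iw => /eqP/ord_inj e; rewrite /si e starK.
Qed.

Local Notation level := (@level k X U M (wt z) cochain (@bar k A V) dop jideal M).

Lemma koszul_level : level.
Proof.
apply: levelP => //.
- exact: cochain0.
- exact: cochain_lin.
- exact: bar_lin.
- move=> *; exact: twop_lin.
- exact: cochain_bar.
- move=> *; exact: bar_bar.
- exact: cochain_dop.
- by move=> n u i F CF; apply: twop_bar => m; apply: cochain_nil CF.
- exact: dop_dop.
- by move=> n u F [CF bF]; apply: cochain_acyclic.
- exact: dop_onto.
- by move=> u t [Ct bt]; apply: jideal0 Ct bt.
- by move=> p c s t js jt w ow aw; rewrite addE sclE js // jt // scaler0 addr0.
- by move=> p t jt w ow aw; apply: jt => //; apply: sub_all aw => l /ltnW.
- by move=> i u t [Ct bt]; apply: jidealD Ct bt.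
- by move=> i u t [Ct bt] jt; have [t0 ct0 jt0] := jideal_onto Ct bt jt; exists t0.
- by move=> i u t [Ct bt]; apply: jideal_inj Ct bt.
Qed.

End Regularity.

(** * Hochschild cochains, the Cartan homotopy and weights *)

Section HochschildCochains.
Variables (k : fieldType) (A : algType k) (V : lmodType k).
Local Notation X := (A -> seq A -> V).
Implicit Types (F : X) (f g : seq A -> V) (m a b : A) (l s : seq A).

Let addE F G m l : (F + G : X) m l = F m l + G m l. Proof. by []. Qed.
Let subE F G m l : (F - G : X) m l = F m l - G m l. Proof. by []. Qed.

Definition mlin1 f := forall l1 l2, linear (fun x => f (l1 ++ x :: l2)).
Definition hcochain n f := mlin1 f /\ forall l, size l != n.+1 -> f l = 0.

Definition curry1 f : X := fun m l => f (m :: l).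
Definition wrap f : X := fun m l => if l is c :: s then f (m * c :: s) else 0.

(** The Hochschild coboundary. The first face is set apart; bar yields the others,
    the cyclic one included. *)
Definition hd f : seq A -> V := fun l =>
  if l is x :: a :: s then f (x * a :: s) - bar (curry1 f) x (a :: s) else 0.

Lemma curry1_mlin f : mlin1 f -> mlin (curry1 f).
Proof. by move=> mf; split=> [l|m l1 l2]; [exact: (mf [::]) | exact: (mf (m :: l1))]. Qed.

Lemma wrap_mlin f : mlin1 f -> mlin (wrap f).
Proof.
move=> mf; split=> [[|a l]|m [|a l1] l2] c x y /=.
- by rewrite scaler0 addr0.
- by rewrite mulrDl -scalerAl (mf [::]).
- by rewrite mulrDr -scalerAr (mf [::]).
- exact: (mf (m * a :: l1)).
Qed.

Lemma bar_wrap f : bar (wrap f) = wrap (hd f).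
Proof.
apply/funext => m; apply/funext => -[|a [|b l]] //.
rewrite bar2 /= mulrA; congr (_ - _).
exact: (bar_mulr a (curry1 f) m (b :: l)).
Qed.

Lemma wrap_inj f g : f [::] = g [::] -> wrap f = wrap g -> f = g.
Proof.
move=> e0 e; apply/funext => -[|a l] //.
by have := congr1 (fun F : X => F 1 (a :: l)) e; rewrite /= mul1r.
Qed.

Let lin_sub (f g : A -> V) : linear f -> linear g -> linear (fun x => f x - g x).
Proof. by move=> lf lg d x y; rewrite lf lg scalerBr opprD addrACA. Qed.

Lemma hd_mlin f : mlin1 f -> mlin1 (hd f).
Proof.
move=> mf; have mb := bar_mlin (curry1_mlin mf).
have l0 : linear (fun=> 0 : V) by move=> c x y; rewrite scaler0 addr0.
case=> [|a [|b l1]] l2.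
- case: l2 => [|b l2]; first exact: l0.
  apply: (lin_sub (f := fun x => f (x * b :: l2))
     (g := fun x => bar (curry1 f) x (b :: l2))); last exact: mb.1.
  by move=> c x y; rewrite mulrDl -scalerAl (mf [::]).
- apply: (lin_sub (f := fun x => f (a * x :: l2))
     (g := fun x => bar (curry1 f) a (x :: l2))); last exact: (mb.2 a [::]).
  by move=> c x y; rewrite mulrDr -scalerAr (mf [::]).
apply: (lin_sub (f := fun x => f (a * b :: l1 ++ x :: l2))
   (g := fun x => bar (curry1 f) a (b :: l1 ++ x :: l2))).
  exact: (mf (a * b :: l1)).
exact: (mb.2 a (b :: l1)).
Qed.

Lemma hd_cochain n f : hcochain n f -> hcochain n.+1 (hd f).
Proof.
move=> [mf zf]; split; first exact: hd_mlin.
move=> [|x [|a l]] //; rewrite eqSS => h; rewrite /hd zf //.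
rewrite (bar_size (P := fun x => x == n)) ?subrr // => m l' h'.
exact: zf.
Qed.

(** Cartan homotopy: inserting h in all positions after the first contracts the
    action of the commutator with h. *)
Variable h : A.

Fixpoint insert F m l : V := match l with
  | [::] => F m [:: h]
  | a :: l' => F m [:: h, a & l'] - insert (pre a F) m l'
  end.

(** The action of the commutator with h on the list; the two products are kept
    apart so that the homotopy formula does not need linearity. *)
Fixpoint lie F m l : V := match l with
  | [::] => 0
  | a :: l' => F m (h * a :: l') - F m (a * h :: l') + lie (pre a F) m l'
  end.

Let insertB F G m l : insert (F - G) m l = insert F m l - insert G m l.
Proof.
elim: l F G => [|a l IH] F G //.
rewrite /= -[pre a (F - G)]/(pre a F - pre a G) IH subE.
rewrite !opprB [LHS]addrACA [RHS]addrACA; congr (_ + _).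
exact: addrC.
Qed.

Lemma insert_mulr z F m l : insert (fun m' s => F (m' * z) s) m l = insert F (m * z) l.
Proof. by elim: l F => [|a l IH] F //=; rewrite -IH. Qed.

Lemma insert_mlin F : mlin F -> mlin (insert F).
Proof.
move=> mF; split=> [l|m l1 l2].
  elim: l F mF => [|a l IH] F mF; first exact: mF.1.
  apply: (lin_sub (f := fun x => F x [:: h, a & l])
    (g := fun x => insert (pre a F) x l)); first exact: mF.1.
  exact: IH (mlin_pre a mF).
elim: l1 F m mF => [|a l1 IH] F m mF; last first.
  apply: (lin_sub (f := fun x => F m [:: h, a & l1 ++ x :: l2])
    (g := fun x => insert (pre a F) m (l1 ++ x :: l2))).
    exact: (mF.2 m [:: h, a & l1]).
  exact: IH (mlin_pre a mF).
apply: (lin_sub (f := fun x => F m [:: h, x & l2])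
    (g := fun x => insert (pre x F) m l2)); first exact: (mF.2 m [:: h]).
elim: l2 F mF => [|b l IHl] F mF; first exact: (mF.2 m [::]).
apply: (lin_sub (f := fun x => F m [:: x, h, b & l])
    (g := fun x => insert (pre b (pre x F)) m l)); first exact: (mF.2 m [::]).
move=> c x y; pose F' : X := fun m l => if l is x :: l' then F m [:: x, b & l'] else 0.
have mF' : mlin F'.
  split=> [[|? ?]|? [|? l1'] l2'] d x' y' /=; rewrite ?scaler0 ?addr0 //.
  - exact: mF.1.
  - exact: (mF.2 _ [::]).
  exact: (mF.2 _ [:: _, b & l1']).
exact: (IHl F' mF' c x y).
Qed.

Let insert_calc (x p q c s d t : V) :
  x - (p - q) - (c - s - d) + (p - s - (q - t)) = x - c + (d + t).
Proof.
rewrite !opprD !opprK !addrA.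
rewrite [LHS](ACl (1*4*6*10*(2*7)*(3*9)*(5*8))%AC) /=.
by rewrite addNr !subrr !addr0.
Qed.

(** The homotopy formula before the ends of the list are joined; the boundary term
    F (h * m) l is half of the commutator with m, and the first face in hd gives
    the other half (cartan). *)
Lemma insert_bar F m l :
  insert (bar F) m l + bar (insert F) m l = lie F m l + F (h * m) l.
Proof.
elim: l F m => [|a l IH] F m; first by rewrite /= addr0 add0r.
pose lmul : X := fun m l => if l is c :: s then F m (a * c :: s) else F (a * m) [::].
have pb : pre a (bar F) = lmul - bar (pre a F).
  apply/funext => m'; apply/funext => -[|b s] //=.
  by rewrite -[RHS]/(F (a * m') [::] - 0) subr0.
have pi : pre a (insert F) = pre a (pre h F) - insert (pre a F) by [].
have -> : insert (bar F) m (a :: l) = F m (h * a :: l) - bar (pre h F) m (a :: l)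
   - (insert lmul m l - insert (bar (pre a F)) m l) by rewrite -insertB -pb.
have IHa := IH (pre a F) m.
have -> : lie F m (a :: l) + F (h * m) (a :: l) =
    F m (h * a :: l) - F m (a * h :: l) + (lie (pre a F) m l + pre a F (h * m) l).
  by rewrite addrA.
rewrite -IHa; case: l IHa {IH} => [|b l] _.
  rewrite addr0 /= opprD opprK !addrA.
  by rewrite [LHS](ACl (1*3*4*(2*5))%AC) /= addNr addr0.
have -> : bar (insert F) m [:: a, b & l] = F m [:: h, a * b & l]
    - insert (pre (a * b) F) m l
    - (bar (pre a (pre h F)) m (b :: l) - bar (insert (pre a F)) m (b :: l)).
  by rewrite bar2 pi barB.
have -> : insert lmul m (b :: l) = F m [:: a * h, b & l]
  - insert (pre (a * b) F) m l by [].
have -> : bar (pre h F) m [:: a, b & l] = F m [:: h, a * b & l]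
    - bar (pre a (pre h F)) m (b :: l) by [].
exact: insert_calc.
Qed.

Definition uncurry1 F : seq A -> V := fun l => if l is m :: l' then F m l' else 0.

Lemma cartan f m a l : hd f = 0 ->
  hd (uncurry1 (insert (curry1 f))) [:: m, a & l] =
  f [:: m * h, a & l] - f [:: h * m, a & l] - lie (curry1 f) m (a :: l).
Proof.
move=> df; pose F := curry1 f.
have bF m' b s : bar F m' (b :: s) = F (m' * b) s.
  have := congr1 (fun g => g [:: m', b & s]) df.
  by rewrite /= => /eqP; rewrite subr_eq0 => /eqP.
rewrite /hd -[curry1 (uncurry1 _)]/(insert F) -[uncurry1 _ _]/(insert F (m * a) l).
have := insert_bar F m (a :: l).
have -> : insert (bar F) m (a :: l) = F (m * h) (a :: l) - insert F (m * a) l.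
  rewrite -insert_mulr -[LHS]/(bar F m [:: h, a & l] - insert (pre a (bar F)) m l).
  rewrite bF; congr (_ - insert _ _ _).
  by apply/funext => m'; apply/funext => s; rewrite /pre bF.
rewrite addrC => /eqP; rewrite eq_sym -subr_eq => /eqP <-.
rewrite -/F; move: (lie F m (a :: l)) => L.
rewrite !opprD !opprK !addrA [LHS](ACl (4*3*2*(1*5))%AC) /=.
by rewrite subrr addr0.
Qed.

End HochschildCochains.

Section Weights.
Variables (k : fieldType) (A : algType k) (U : zmodType) (M : nat).
Variables (z : color_weyl A U M) (V : lmodType k).
Hypothesis char0 : [pchar k] =i pred0.
Local Notation word := (seq 'I_M).
Local Notation mon := (mon z).
Local Notation wtw := (wtw z).
Local Notation X := (A -> seq A -> V).
Implicit Types (f g : seq A -> V) (F : X) (w v : word) (ws : seq word) (u : U).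

Local Notation wts ws := (\sum_(v <- ws) wtw v).

Definition hsupported u f := forall ws, wts ws != u -> f (map mon ws) = 0.

Lemma words_eq0 f : mlin1 f -> (forall ws, f (map mon ws) = 0) -> f = 0.
Proof.
move=> mf f0; apply/funext => l.
suff E ws : f (map mon ws ++ l) = 0 by exact: (E [::]).
elim: l ws => [|a l IH] ws; first by rewrite cats0 f0.
apply: (lspan_eq0 (f := fun x => f (map mon ws ++ x :: l)) _ _ (ordered_span z a)).
  exact: mf.
by move=> _ [w _ ->]; rewrite -cat_rcons -map_rcons.
Qed.

Lemma words_eq f g : mlin1 f -> mlin1 g ->
  (forall ws, f (map mon ws) = g (map mon ws)) -> f = g.
Proof.
move=> mf mg e; apply/eqP; rewrite -subr_eq0; apply/eqP.
apply: words_eq0 => [l1 l2 c x y|ws]; last first.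
  by rewrite -[(f - g) _]/(f (map mon ws) - g (map mon ws)) e subrr.
rewrite -![(f - g) _]/(f _ - g _) mf mg.
by rewrite scalerBr opprD addrACA.
Qed.

(** The multilinear function that agrees with fam u in weight u. Gluing lets one
    treat each weight separately although a cochain may have infinitely many
    nonzero components. *)
Fixpoint glue (fam : U -> seq A -> V) (l : seq A) : V := match l with
  | [::] => fam 0 [::]
  | a :: l' => ext z (fun w =>
      glue (fun u s => fam (wtw w + u) (mon w :: s)) l') a
  end.

Lemma glue_mon fam ws : (forall u, mlin1 (fam u)) ->
  glue fam (map mon ws) = fam (wts ws) (map mon ws).
Proof.
elim: ws fam => [|w ws IH] fam mf; first by rewrite big_nil.
rewrite big_cons /=; set h := fun w => _.
pose g a := ext z h a - fam (wtw w + wts ws) (a :: map mon ws).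
have /eqP : g (mon w) = 0; last by rewrite subr_eq0 => /eqP.
apply: (lspan_eq0 (f := g)) (omons_mon z w) => [c x y|_ [v [ov _ wv ->]]].
  by rewrite /g (ext_linear z char0) (mf _ [::]) scalerBr opprD addrACA.
rewrite /g (ext_mon z char0) // /h IH ?wv ?subrr // => u l1 l2.
exact: (mf _ (mon v :: l1)).
Qed.

Lemma glue_cochain n fam : (forall u, hcochain n (fam u)) -> hcochain n (glue fam).
Proof.
move=> Cf; split.
  have mf u := (Cf u).1; move=> l1 l2.
  elim: l1 fam mf {Cf} => [|a l1 IH] fam mf.
    exact: (ext_linear z char0).
  move=> c x y /=; rewrite -ext_lin; apply: ext_eq => w _; apply: IH => u l1' l2'.
  exact: (mf _ (mon w :: l1')).
suff E (Q : nat -> bool) : (forall u l, ~~ Q (size l) -> fam u l = 0) ->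
    forall l, ~~ Q (size l) -> glue fam l = 0.
  by apply: (E (fun x => x == n.+1)) => u; exact: (Cf u).2.
move=> zf l; elim: l Q fam zf {Cf} => [|a l IH] Q fam zf h /=; first exact: zf.
transitivity (ext z (fun=> 0 : V) a); last first.
  by rewrite /ext linextE big1 // => w _; rewrite scaler0.
apply: ext_eq => w _; apply: (IH (fun x => Q x.+1)) => // u s hs.
exact: zf.
Qed.

Lemma bar_glue (fam : U -> X) F :
    (forall w ws, F (mon w) (map mon ws) =
       fam (wtw w + wts ws) (mon w) (map mon ws)) ->
  forall w ws, bar F (mon w) (map mon ws) =
    bar (fam (wtw w + wts ws)) (mon w) (map mon ws).
Proof.
move=> e w [|a ws] //.
elim: ws a fam F e => [|b ws IH] a fam F e.
  rewrite !bar1 -mon_cat (e _ [::]) big_seq1 big_nil addr0 wtw_cat.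
  by rewrite [wtw a + _]addrC.
have e' w' ws' : pre (mon a) F (mon w') (map mon ws') =
    pre (mon a) (fam (wtw a + (wtw w' + wts ws'))) (mon w') (map mon ws').
  by rewrite /pre (e w' (a :: ws')) big_cons addrCA.
have := IH b (fun x => pre (mon a) (fam (wtw a + x))) _ e'.
rewrite -[map mon (b :: ws)]/(mon b :: map mon ws) => {}IH.
rewrite !bar2 -mon_cat (e w ((a ++ b) :: ws)) IH !big_cons wtw_cat.
by rewrite -!addrA [wtw a + (wtw w + _)]addrCA.
Qed.

Lemma hd_glue fam ws : (forall u, mlin1 (fam u)) ->
  hd (glue fam) (map mon ws) = hd (fam (wts ws)) (map mon ws).
Proof.
move=> mf; case: ws => [|w [|a ws]] //.
have hd2 (g : seq A -> V) : hd g (map mon [:: w, a & ws]) =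
  g (map mon ((w ++ a) :: ws)) - bar (curry1 g) (mon w) (map mon (a :: ws)).
  by rewrite /= mon_cat.
rewrite !hd2 glue_mon // (bar_glue (fam := fun u => curry1 (fam u))).
  by rewrite !big_cons wtw_cat addrA.
by move=> w' ws'; rewrite /curry1 (glue_mon (w' :: ws')) // big_cons.
Qed.

End Weights.

(** * Hochschild cohomology with values in a vector space *)

Section Cohomology.
Variables (k : fieldType) (A : algType k) (U : zmodType) (M : nat).
Variable z : color_weyl A U M.
Hypothesis char0 : [pchar k] =i pred0.
Local Notation word := (seq 'I_M).
Local Notation mon := (mon z).
Local Notation wtw := (wtw z).
Implicit Types (V : lmodType k) (w : word) (ws : seq word) (u : U).
Local Notation wts ws := (\sum_(v <- ws) wtw v).
Local Notation hsupported := (hsupported z).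

Definition hcob V n (f : seq A -> V) := match n with
  | 0 => f = 0
  | n'.+1 => exists2 g, hcochain n' g & hd g = f
  end.

Lemma hd_lin V c (f g : seq A -> V) : hd (c *: f + g) = c *: hd f + hd g.
Proof.
apply/funext => -[|x [|a l]]; rewrite -[RHS]/(c *: hd f _ + hd g _) /hd;
  rewrite ?scaler0 ?addr0 //.
rewrite -[curry1 _]/(c *: curry1 f + curry1 g) bar_lin.
by rewrite scalerBr addrACA -opprD.
Qed.

Lemma hd0 V : hd (0 : seq A -> V) = 0.
Proof.
by have := hd_lin (-1) 0 (0 : seq A -> V); rewrite scaler0 addr0 scaleN1r addNr.
Qed.

Section Words.
Variables (V : lmodType k) (f : seq A -> V).

(** In weight u != 0 some commutator acts by a nonzero scalar, and the Cartan
    homotopy divided by this scalar is a primitive. *)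
Lemma cartan_cob n u : u != 0 -> hcochain n f -> hsupported u f -> hd f = 0 ->
  hcob n f.
Proof.
move=> u0 [mf zf] sf df; have [h [om [omD omu hz]]] := gen_euler z u0.
have om0 : om 0 = 0.
  by apply: (addrI (om 0)); rewrite -omD !addr0.
have hmon := comm_mon omD hz.
have hslot l1 l2 w : f (l1 ++ h * mon w :: l2) - f (l1 ++ mon w * h :: l2)
    = om (wtw w) *: f (l1 ++ mon w :: l2).
  by rewrite -(linB (mf l1 l2)) hmon (linZ (mf l1 l2)).
have lieE l1 w ws : lie h (fun m s => f (m :: l1 ++ s)) (mon w) (map mon ws) =
    om (wts ws) *: f (mon w :: l1 ++ map mon ws).
  elim: ws l1 => [|a ws IH] l1; first by rewrite big_nil om0 scale0r.
  rewrite big_cons omD scalerDl /= (hslot (mon w :: l1)); congr (_ + _).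
  have := IH (rcons l1 (mon a)).
  by rewrite cat_rcons => <-; congr (lie _ _ _ _); apply/funext => m;
    apply/funext => s; rewrite /pre cat_rcons.
case: n zf => [|n] zf.
  apply: (words_eq0 (z := z)) => // -[|w [|? ?]]; do 1?exact: zf.
  have [e|] := eqVneq (wtw w) u; last by move=> ne; apply: sf; rewrite big_seq1.
  have := congr1 (fun g => g [:: mon w; h]) df.
  rewrite /hd bar1 /curry1 => /eqP; rewrite subr_eq0 => /eqP ehw.
  have /eqP := hslot [::] [::] w; rewrite /= ehw subrr eq_sym scaler_eq0 e.
  by rewrite (negbTE omu) => /eqP.
pose F := curry1 f; pose g := uncurry1 (insert h F).
have Cg : hcochain n g.
  split=> [[|m l1] l2|[|m l] //].
  - exact: (insert_mlin h (curry1_mlin mf)).1.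
  - exact: (insert_mlin h (curry1_mlin mf)).2.
  rewrite eqSS => sl /=.
  have E (Q : nat -> bool) (G : A -> seq A -> V) l' :
      (forall m l, ~~ Q (size l) -> G m l = 0) -> ~~ Q (size l').+1 ->
      insert h G m l' = 0.
    elim: l' Q G => [|a l' IH] Q G zG hQ /=; first exact: zG.
    rewrite zG //; rewrite (IH (fun x => Q x.+1)) ?subrr // => ? ? ?.
    exact: zG.
  by apply: (E (fun x => x == n.+1)) => // m' l' h'; apply: zf.
exists ((- om u)^-1 *: g).
  split=> [l1 l2 c x y|l sl]; last first.
    by rewrite -[LHS]/((- om u)^-1 *: g l) Cg.2 ?scaler0.
  rewrite -![(_ *: g) _]/(_ *: g _) Cg.1.
  by rewrite scalerDr !scalerA mulrC.
rewrite -[_ *: g]addr0 hd_lin.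
rewrite hd0 addr0; apply: (words_eq (z := z)) => // [l1 l2 c x y|].
  rewrite -![(_ *: hd g) _]/(_ *: hd g _) (hd_mlin Cg.1).
  by rewrite scalerDr !scalerA mulrC.
case=> [|w [|a ws]].
- by rewrite zf // -[LHS]/(_ *: 0) scaler0.
- by rewrite zf // -[LHS]/(_ *: 0) scaler0.
rewrite -[LHS]/((- om u)^-1 *: hd g (map mon [:: w, a & ws])).
have -> : hd g (map mon [:: w, a & ws]) = - om (wtw w + wts (a :: ws)) *:
    f (map mon [:: w, a & ws]).
  rewrite /g -[map mon _]/[:: mon w, mon a & map mon ws] cartan //.
  have e1 := hslot [::] (mon a :: map mon ws) w; rewrite !cat0s in e1.
  have e2 := lieE [::] w (a :: ws).
  rewrite -[f [:: _, _ & _] - _]opprB e1.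
  rewrite -[curry1 f]/(fun m s => f (m :: [::] ++ s)) e2.
  by rewrite -opprD -scalerDl -omD scaleNr.
have [e|ne] := eqVneq (wtw w + wts (a :: ws)) u.
  by rewrite e scalerA mulVf ?scale1r // oppr_eq0.
by rewrite (sf [:: w, a & ws]) ?scaler0 // big_cons.
Qed.

End Words.


Section Koszul.
Variable V : lmodType k.
Implicit Types (f g : seq A -> V) (F G : A -> seq A -> V).

Lemma hcochain_nil n f : hcochain n f -> f [::] = 0.
Proof. by case=> _; apply. Qed.

Lemma wrap_cochain n f : hcochain n f -> hsupported 0 f -> cochain z n 0 (wrap f).
Proof.
move=> [mf zf] sf; split; first exact: wrap_mlin.
  by move=> m [|c s] // h; apply: zf.
move=> w [|v ws] //; rewrite big_cons /= -mon_cat => h.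
by apply: (sf ((w ++ v) :: ws)); rewrite big_cons wtw_cat -addrA.
Qed.

Lemma wrap_stab i f : dop z i 0 (wrap f) = 0.
Proof.
apply/funext => m; apply/funext => -[|c s] //.
by rewrite /dop /= chi0 scale1r mulrA subrr.
Qed.

(** Moving the letters of c one by one to m shows that an invariant cochain of
    weight 0 depends only on m * c. *)
Lemma wrap_onto n G : cochain z n 0 G -> (forall i, dop z i 0 G = 0) ->
  exists g, [/\ hcochain n g, hsupported 0 g & wrap g = G].
Proof.
move=> [mG zG sG] stG; exists (fun l => if l is a :: s then G a (1 :: s) else 0).
have slide w m s : G m (mon w :: s) = G (m * mon w) (1 :: s).
  elim: w m => [|i w IH] m; first by rewrite mon0 mulr1.
  have := congr1 (fun F : A -> seq A -> V => F m (mon w :: s)) (stG i).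
  rewrite /dop /= chi0 scale1r -mon_cons => /eqP; rewrite subr_eq0 => /eqP->.
  by rewrite IH -mulrA mon_cons.
split.
- split=> [[|a l1] l2|[|a l] //].
  + exact: mG.1.
  + exact: (mG.2 a (1 :: l1)).
  by move=> h; apply: zG.
- move=> [|w ws] // h; rewrite /= -(mon0 z); apply: (sG w ([::] :: ws)).
  by move: h; rewrite !big_cons wtw0 add0r.
apply/funext => m; apply/funext => -[|c s]; first by rewrite /= zG.
apply/eqP; rewrite eq_sym -subr_eq0; apply/eqP; rewrite /=.
apply: (lspan_eq0 (f := fun x => G m (x :: s) - G (m * x) (1 :: s))) (ordered_span z c).
  move=> d x y; rewrite (mG.2 m [::]) mulrDr -scalerAr mG.1.
  by rewrite scalerBr opprD addrACA.
by move=> _ [w _ ->]; rewrite slide subrr.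
Qed.

Let stabT F : (forall i, dop z i 0 F = 0) <->
  stab (@dop k A U M z _) M 0 F.
Proof. by split=> h i // *; apply: h. Qed.

Let hd_wrap f g n : hcochain n f -> bar (wrap g) = wrap f -> hd g = f.
Proof.
by move=> Cf; rewrite bar_wrap; apply: wrap_inj; rewrite (hcochain_nil Cf).
Qed.

Local Notation cobM n F :=
  (cob (@cochain k A U M z V) (@bar k A V) (@dop k A U M z V) n M 0 F).
Local Notation zigM F t :=
  (zig (wt z) (@cochain k A U M z V) (@bar k A V) (@dop k A U M z V) M 0 F t).

Lemma cob_wrap n f : hcochain n f ->
  cobM n (wrap f) <->
  (if n is n'.+1 then exists g, [/\ hcochain n' g, hsupported 0 g & hd g = f]
   else f = 0).
Proof.
case: n => [|n] Cf; split=> /=.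
- move=> e; apply: wrap_inj; first exact: hcochain_nil Cf.
  by rewrite e; apply/funext => m; apply/funext => -[].
- by move=> ->; apply/funext => m; apply/funext => -[].
- move=> [G [CG sG bG]]; have [g [Cg sg wg]] := wrap_onto CG ((stabT G).2 sG).
  by exists g; split=> //; apply: hd_wrap Cf _; rewrite wg.
move=> [g [Cg sg dg]]; exists (wrap g); split.
- exact: wrap_cochain.
- by apply/stabT => i; apply: wrap_stab.
- by rewrite bar_wrap dg.
Qed.

Lemma koszul_vanish n f : n <> M -> hcochain n f -> hsupported 0 f -> hd f = 0 ->
  hcob n f.
Proof.
move=> nM Cf sf df; have [van _ _ _] := koszul_level z V char0.
have /(cob_wrap Cf) : cobM n (wrap f).
  apply: van => //; first exact: wrap_cochain.
    by apply/stabT => i; apply: wrap_stab.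
  by rewrite bar_wrap df; apply/funext => m; apply/funext => -[].
by case: (n) => // n' [g [Cg _ dg]]; exists g.
Qed.

Lemma koszul_zig f : hcochain M f -> hsupported 0 f -> hd f = 0 ->
  exists t, zigM (wrap f) t.
Proof.
move=> Cf sf df; have [_ tot _ _] := koszul_level z V char0.
apply: tot; first exact: wrap_cochain.
  by apply/stabT => i; apply: wrap_stab.
by rewrite bar_wrap df; apply/funext => m; apply/funext => -[].
Qed.

(** After all M steps jideal only tests the empty word, so the class of F is given
    by the value at 1 of the form t. *)
Lemma koszul_cob F t : zigM F t -> t 1 [:: 1] = 0 <-> cobM M F.
Proof.
move=> zt; have [_ _ _ cobE] := koszul_level z V char0.
split=> [t0|/(cobE _ _ _ zt) jt].
  apply/(cobE _ _ _ zt) => -[|i w] _; first by rewrite mon0.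
  by rewrite /= leqNgt ltn_ord.
by rewrite -[X in t X](mon0 z); apply: jt.
Qed.

End Koszul.

Local Notation zigM V F t :=
  (zig (wt z) (@cochain k A U M z V) (@bar k A V) (@dop k A U M z V) M 0 F t).

Lemma bar_map (V W : lmodType k) (phi : V -> W) (F : A -> seq A -> V) :
  linear phi -> bar (fun m l => phi (F m l)) = fun m l => phi (bar F m l).
Proof.
move=> lp; apply/funext => m; apply/funext => -[|a l]; first by rewrite /= (lin0 lp).
elim: l F a => [|b l IH] F a //.
rewrite !bar2 (linB lp); congr (_ - _); exact: (IH (pre a F)).
Qed.

Lemma hd_map (V W : lmodType k) (phi : V -> W) (f : seq A -> V) :
  linear phi -> hd (fun l => phi (f l)) = fun l => phi (hd f l).
Proof.
move=> lp; apply/funext => -[|x [|a l]]; rewrite /hd ?(lin0 lp) //.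
by rewrite (linB lp) -[curry1 _ in LHS]/(fun m s => phi (curry1 f m s)) bar_map.
Qed.

Lemma zig_map (V W : lmodType k) (phi : V -> W) p u F t : linear phi ->
  zig (wt z) (@cochain k A U M z V) (@bar k A V) (@dop k A U M z V) p u F t ->
  zig (wt z) (@cochain k A U M z W) (@bar k A W) (@dop k A U M z W) p u
    (fun m l => phi (F m l)) (fun m l => phi (t m l)).
Proof.
move=> lp; have phi0 := lin0 lp.
have barE F' := bar_map F' lp.
have dopE i u' (F' : A -> seq A -> V) :
    dop z i u' (fun m l => phi (F' m l)) = fun m l => phi (dop z i u' F' m l).
  apply/funext => m; apply/funext => -[|a l] //.
  by rewrite /dop /= (linB lp) (linZ lp).
have CE n u' (F' : A -> seq A -> V) :
    cochain z n u' F' -> cochain z n u' (fun m l => phi (F' m l)).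
  move=> [mF zF sF]; split.
  - split=> [l|m l1 l2] c x y; first by rewrite mF.1 lp.
    by rewrite mF.2 lp.
  - by move=> m l h; rewrite zF.
  - by move=> w ws h; rewrite sF.
have sE q u' (F' : A -> seq A -> V) : stab (@dop k A U M z _) q u' F' ->
    stab (@dop k A U M z _) q u' (fun m l => phi (F' m l)).
  move=> sF i iq; rewrite dopE sF //.
  by apply/funext => m; apply/funext => l.
elim: p u F => [|p IH] u F /=.
  move=> [-> [Ct bt]]; split=> //; split; first exact: CE.
  by rewrite barE bt; apply/funext => m; apply/funext => l.
move=> [i [G [ip CG sG <- [sF zG]]]].
exists i, (fun m l => phi (G m l)); split=> //; first exact: CE.
- exact: sE.
- by split; [exact: sE | rewrite dopE; apply: IH].
Qed.

(** The cocycle phi corresponds to the form that reads off the constant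
    coefficient; a cocycle f with corresponding form t has the class of phi
    times t(1). *)
Lemma top_class : exists phi : seq A -> k^o,
  [/\ hcochain M phi, hsupported 0 phi, hd phi = 0 &
   forall V : lmodType k,
   (forall f : seq A -> V, hcochain M f -> hsupported 0 f -> hd f = 0 ->
     exists v, hcob M (f - (fun l => phi l *: v))) /\
   (forall (v : V) n (g : seq A -> V), M = n.+1 -> hcochain n g -> hsupported 0 g ->
     hd g = (fun l => phi l *: v) -> v = 0)].
Proof.
pose e : word -> k^o := fun w => (w == [::])%:R.
have [|Ce be] := @trace_cocP k A U M z k^o char0 0 e.
  by rewrite /e => -[|i w] _ //; rewrite wtw0 eqxx.
have e1 : trace_coc z e 1 [:: 1] = 1.
  by rewrite /trace_coc mulr1 -(mon0 z) (ext_mon z char0).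
have [_ _ onto _] := koszul_level z (k^o : lmodType k) char0.
have [|F zF] := onto 0 (trace_coc z e).
  split=> //; rewrite /shift (eq_bigl xpredT) => [|i]; last by rewrite ltn_ord.
  by rewrite wt_sum subr0.
have [CF sF bF _] := zig_coc (@cochain_bar k A U M z k^o)
  (fun _ _ F' _ => bar_bar F') (leqnn M) zF.
have [phi [Cphi sphi wphi]] := wrap_onto CF (fun i => sF i (ltn_ord i)).
exists phi; split=> //.
  apply: wrap_inj => //; rewrite -bar_wrap wphi bF.
  by apply/funext => m; apply/funext => -[].
move=> V.
have Cv (v : V) : hcochain M (fun l => phi l *: v).
  split=> [l1 l2 c x y|l /Cphi.2->]; last by rewrite scale0r.
  by rewrite Cphi.1 scalerDl scalerA.
have zv (v : V) : zigM V (wrap (fun l => phi l *: v))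
    (fun m l => trace_coc z e m l *: v).
  have -> : wrap (fun l => phi l *: v) = fun m l => F m l *: v.
    rewrite -wphi; apply/funext => m; apply/funext => -[|a l] //=.
    by rewrite scale0r.
  apply: (zig_map (phi := fun c : k^o => c *: v)) zF => c x y.
  by rewrite scalerDl scalerA.
split=> [f Cf sf df|v n g eM Cg sg dg].
  have [t zt] := koszul_zig Cf sf df; exists (t 1 [:: 1]).
  have := zig_lin (@cochain_lin k A U M z V) (@bar_lin k A V)
     (fun i u => twop_lin (z i) (chi z i u)) (-1) (zv (t 1 [:: 1])) zt.
  have -> : -1 *: wrap (fun l => phi l *: t 1 [:: 1]) + wrap f =
      wrap (f - (fun l => phi l *: t 1 [:: 1])).
    rewrite scaleN1r addrC; apply/funext => m; apply/funext => -[|a l] //.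
    by rewrite -[LHS]/(0 - 0) subr0.
  have Cd : hcochain M (f - (fun l => phi l *: t 1 [:: 1])).
    have Ct := Cv (t 1 [:: 1]); set h := fun l => _ in Ct *.
    split=> [l1 l2 c x y|l hl]; rewrite -![(f - h) _]/(f _ - h _).
      by rewrite Cf.1 Ct.1 scalerBr opprD addrACA.
    by rewrite Cf.2 // Ct.2 // subrr.
  set t' := _ + t => zd.
  have /(koszul_cob zd)/(cob_wrap Cd) : t' 1 [:: 1] = 0.
    rewrite -[LHS]/(-1 *: (trace_coc z e 1 [:: 1] *: t 1 [:: 1]) + t 1 [:: 1]).
    by rewrite e1 scale1r scaleN1r addNr.
  move: (f - _) => f'.
  suff E m : (if m is n'.+1 then exists g : seq A -> V,
      [/\ hcochain n' g, hsupported 0 g & hd g = f'] else f' = 0) -> hcob m f'.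
    exact: E.
  by case: m => // n [g [Cg _ dg]]; exists g.
have := koszul_cob (zv v); rewrite e1 scale1r => -[_]; apply.
apply/(cob_wrap (Cv v)).
suff E m : m = n.+1 -> if m is n'.+1 then exists g : seq A -> V,
    [/\ hcochain n' g, hsupported 0 g & hd g = fun l => phi l *: v]
    else (fun l => phi l *: v) = 0 by exact: E eM.
by move=> ->; exists g.
Qed.

Lemma hcochain0 V n : hcochain n (0 : seq A -> V).
Proof. by split=> // l1 l2 c x y; rewrite -[RHS]/(c *: 0 + 0) scaler0 addr0. Qed.

Definition wpart V u (f : seq A -> V) :=
  glue z (fun v => if v == u then f else 0).

Section WeightParts.
Variables (V : lmodType k) (n : nat) (f : seq A -> V).
Hypothesis Cf : hcochain n f.

Let famC u v : hcochain n (if v == u then f else 0).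
Proof. by case: ifP => _; [exact: Cf | exact: hcochain0]. Qed.

Lemma wpart_cochain u : hcochain n (wpart u f).
Proof. exact: glue_cochain. Qed.

Lemma wpart_mon u ws :
  wpart u f (map mon ws) = if wts ws == u then f (map mon ws) else 0.
Proof.
rewrite /wpart (glue_mon z char0) => [|v]; first by case: ifP.
exact: (famC u v).1.
Qed.

Lemma wpart_supported u : hsupported u (wpart u f).
Proof. by move=> ws /negbTE h; rewrite wpart_mon h. Qed.

Lemma hd_wpart u ws :
  hd (wpart u f) (map mon ws) = if wts ws == u then hd f (map mon ws) else 0.
Proof.
rewrite /wpart (hd_glue z char0) => [|v]; last exact: (famC u v).1.
by case: ifP => // _; rewrite hd0.
Qed.

Lemma hd_wpart0 u : hd f = 0 -> hd (wpart u f) = 0.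
Proof.
move=> df; apply: (words_eq0 (z := z)); first by apply: hd_mlin; case: (wpart_cochain u).
by move=> ws; rewrite hd_wpart df; case: ifP.
Qed.

Lemma hcob_glue : (forall u, hcob n (wpart u f)) -> hcob n f.
Proof.
have [mf zf] := Cf; case: n Cf zf => [|n'] Cf' zf h /=.
  apply: (words_eq0 (z := z)) => // ws.
  by rewrite -[LHS]/(if true then f (map mon ws) else 0) -(eqxx (wts ws)) -wpart_mon h.
have [g gP] := choice (fun u => (let: ex_intro2 g Cg dg := h u in
  ex_intro (fun g => hcochain n' g /\ hd g = wpart u f) g (conj Cg dg))).
exists (glue z g); first by apply: glue_cochain => // u; case: (gP u).
apply: (words_eq (z := z)) => //.
  by apply: hd_mlin; case: (glue_cochain z char0 (fun u => (gP u).1)).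
move=> ws; rewrite (hd_glue z char0) => [|u]; last by case: (gP u) => [[]].
by have [_ ->] := gP (wts ws); rewrite wpart_mon eqxx.
Qed.

End WeightParts.

Theorem hochschild_vanish V n (f : seq A -> V) : n <> M ->
  hcochain n f -> hd f = 0 -> hcob n f.
Proof.
move=> nM Cf df; apply: hcob_glue => // u.
have Cu := wpart_cochain Cf u; have du := hd_wpart0 Cf u df.
have su := @wpart_supported _ _ _ Cf u.
have [e|u0] := eqVneq u 0; last exact: cartan_cob u0 Cu su du.
by rewrite e in Cu du su *; apply: koszul_vanish.
Qed.

Theorem hochschild_top : exists phi : seq A -> k^o,
  [/\ hcochain M phi, hd phi = 0 & forall V : lmodType k,
   (forall f : seq A -> V, hcochain M f -> hd f = 0 ->
     exists v, hcob M (f - (fun l => phi l *: v))) /\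
   (forall (v : V) n (g : seq A -> V), M = n.+1 -> hcochain n g ->
     hd g = (fun l => phi l *: v) -> v = 0)].
Proof.
have [phi [Cphi sphi dphi phiP]] := top_class.
exists phi; split=> // V; have [top top0] := phiP V.
have Cv (v : V) : hcochain M (fun l => phi l *: v).
  split=> [l1 l2 c x y|l /Cphi.2->]; last by rewrite scale0r.
  by rewrite Cphi.1 scalerDl scalerA.
split=> [f Cf df|v n g eM Cg dg].
  have sf := wpart_supported Cf (u := 0).
  have [v vP] := top _ (wpart_cochain Cf 0) sf (hd_wpart0 Cf 0 df).
  exists v; set h := fun l => _ in vP *.
  have Ch : hcochain M h := Cv v.
  have Cd : hcochain M (f - h).
    split=> [l1 l2 c x y|l hl]; rewrite -![(f - h) _]/(f _ - h _).
      by rewrite Cf.1 Ch.1 scalerBr opprD addrACA.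
    by rewrite Cf.2 // Ch.2 // subrr.
  have dh : hd h = 0.
    rewrite (hd_map (phi := fun c : k^o => c *: v)) => [|c x y]; last first.
      by rewrite scalerDl scalerA.
    by rewrite dphi; apply/funext => l; rewrite scale0r.
  have dd : hd (f - h) = 0.
    by rewrite addrC -scaleN1r hd_lin dh df scaler0 addr0.
  apply: hcob_glue => // u.
  have [->|u0] := eqVneq u 0; last first.
    have su := wpart_supported Cd (u := u).
    exact: cartan_cob u0 (wpart_cochain Cd u) su (hd_wpart0 Cd u dd).
  suff -> : wpart 0 (f - h) = wpart 0 f - h by [].
  apply: (words_eq (z := z)); first by case: (wpart_cochain Cd 0).
    move=> l1 l2 c x y; rewrite -![(_ - h) _]/(_ - h _).
    rewrite (wpart_cochain Cf 0).1 Ch.1.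
    by rewrite scalerBr opprD addrACA.
  move=> ws; rewrite -[RHS]/(wpart 0 f _ - h _) (wpart_mon Cd) (wpart_mon Cf).
  rewrite -[(f - h) _]/(f _ - h _).
  by case: eqVneq => // /sphi; rewrite /h => ->; rewrite scale0r subr0.
apply: (top0 v n (wpart 0 g) eM); first exact: wpart_cochain.
  exact: wpart_supported Cg _.
apply: (words_eq (z := z)); first by apply: hd_mlin; case: (wpart_cochain Cg 0).
  exact: (Cv v).1.
move=> ws; rewrite (hd_wpart Cg) dg; case: eqVneq => // /sphi->.
by rewrite scale0r.
Qed.

End Cohomology.

(** * Cochains and tensor powers *)

Section Tensors.
Variables (k : fieldType) (A : algType k).
Implicit Types (V : lmodType k) (l s : seq A).

Definition ffun_seq n (a : {ffun 'I_n -> A}) : seq A := [seq a i | i <- enum 'I_n].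
Definition seq_ffun n l : {ffun 'I_n -> A} := [ffun i : 'I_n => nth 0 l i].

Lemma size_ffun_seq n (a : {ffun 'I_n -> A}) : size (ffun_seq a) = n.
Proof. by rewrite size_map size_enum_ord. Qed.

Lemma nth_ffun_seq n (a : {ffun 'I_n -> A}) (i : 'I_n) : nth 0 (ffun_seq a) i = a i.
Proof. by rewrite (nth_map i) ?size_enum_ord // nth_ord_enum. Qed.

Lemma ffun_seqK n (a : {ffun 'I_n -> A}) : seq_ffun n (ffun_seq a) = a.
Proof. by apply/ffunP => i; rewrite ffunE nth_ffun_seq. Qed.

Lemma seq_ffunK n l : size l = n -> ffun_seq (seq_ffun n l) = l.
Proof.
move=> ln; apply: (@eq_from_nth _ 0); rewrite size_ffun_seq // => i lt_in.
by rewrite (nth_ffun_seq _ (Ordinal lt_in)) ffunE.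
Qed.

Lemma ffun_seq_upd n (a : {ffun 'I_n -> A}) i x :
  ffun_seq (ffun_upd a i x) = take i (ffun_seq a) ++ x :: drop i.+1 (ffun_seq a).
Proof.
have st : size (take i (ffun_seq a)) = i.
  by rewrite size_take size_ffun_seq ltn_ord.
apply: (@eq_from_nth _ 0).
  rewrite size_cat st /= size_drop !size_ffun_seq.
  by rewrite addnS -addSn subnKC.
rewrite size_ffun_seq => j lt_jn.
rewrite (nth_ffun_seq _ (Ordinal lt_jn)) ffunE nth_cat st -val_eqE /=.
case: ltngtP => [ji|ij|ji].
- by rewrite nth_take // (nth_ffun_seq _ (Ordinal lt_jn)).
- rewrite -[(j - i)%N]prednK ?subn_gt0 //= nth_drop -subnS subnKC //.
  by rewrite (nth_ffun_seq _ (Ordinal lt_jn)).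
by rewrite ji subnn.
Qed.

Lemma seq_ffun_upd n l1 l2 x : size (l1 ++ x :: l2) = n ->
  exists a i, forall y, seq_ffun n (l1 ++ y :: l2) = ffun_upd a i y.
Proof.
move=> sn; have lt : (size l1 < n)%N by rewrite -sn size_cat /= -addSnnS leq_addr.
exists (seq_ffun n (l1 ++ x :: l2)), (Ordinal lt) => y.
apply/ffunP => j; rewrite !ffunE -val_eqE /= !nth_cat.
case: ltngtP => // [ji|->]; last by rewrite subnn.
by rewrite -[(j - size l1)%N]prednK ?subn_gt0.
Qed.

Section Lift.
Variable V : lmodType k.

(** n-cochains are the linear maps on the tensor power. *)
Definition tlift n (f : seq A -> V) : tensorpow A n -> V :=
  quot_lift (linext (fun a : {ffun 'I_n -> A} => f (ffun_seq a))).

Let tlift_rel n (f : seq A -> V) : mlin1 f -> forall x : {malg k[{ffun 'I_n -> A}]},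
  multilin_rel x -> linext (fun a : {ffun 'I_n -> A} => f (ffun_seq a)) x = 0.
Proof.
move=> mf _ [a i c u v]; rewrite linearB linearP /= !linextU !ffun_seq_upd.
by rewrite mf subrr.
Qed.

Lemma tlift_linear n (f : seq A -> V) : mlin1 f -> linear (@tlift n f).
Proof. by move=> mf; apply: quot_lift_is_linear; apply: tlift_rel. Qed.

Lemma tliftE n (f : seq A -> V) (a : {ffun 'I_n -> A}) :
  mlin1 f -> tlift f (tens a) = f (ffun_seq a).
Proof. by move=> mf; rewrite /tlift quot_liftE /= ?linextU //; apply: tlift_rel. Qed.

Definition tfun n (phi : tensorpow A n -> V) l : V :=
  if size l == n then phi (tens (seq_ffun n l)) else 0.

Lemma tfun_cochain n (phi : tensorpow A n.+1 -> V) :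
  linear phi -> hcochain n (tfun phi).
Proof.
move=> lp; split=> [l1 l2 c x y|l sl]; last by rewrite /tfun (negbTE sl).
rewrite /tfun.
have sE w : size (l1 ++ w :: l2) = size (l1 ++ 0 :: l2) by rewrite !size_cat.
rewrite !sE; case: eqP => [sn|_]; last by rewrite scaler0 addr0.
have [a [i e]] := seq_ffun_upd sn.
by rewrite !e tensP lp.
Qed.

Lemma tfunE n (phi : tensorpow A n -> V) a : tfun phi (ffun_seq a) = phi (tens a).
Proof. by rewrite /tfun size_ffun_seq eqxx ffun_seqK. Qed.

Lemma tens_ext n (phi psi : tensorpow A n -> V) : linear phi -> linear psi ->
  (forall a, phi (tens a) = psi (tens a)) -> forall x, phi x = psi x.
Proof.
move=> lp lq e x; rewrite -(quot_reprK x).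
set g := quot_repr x; rewrite [g]monalgE.
have : forall s : seq {ffun 'I_n -> A}, forall c : {ffun 'I_n -> A} -> k,
   phi (quot_proj (@multilin_rel k A n) (\sum_(a <- s) << c a *g a >>)) =
   psi (quot_proj (@multilin_rel k A n) (\sum_(a <- s) << c a *g a >>)).
  move=> s c; elim: s => [|a s IH].
    by rewrite !big_nil linear0 (lin0 lp) (lin0 lq).
  rewrite !big_cons linearD /= (linD lp) (linD lq) IH; congr (_ + _).
  have -> : << c a *g a >> = c a *: << a >> :> {malg k[{ffun 'I_n -> A}]}.
    by apply/malgP => b; rewrite mcoeffZ !mcoeffU mulrnAr mulr1.
  by rewrite linearZ /= (linZ lp) (linZ lq); congr (_ *: _); exact: e.
exact.
Qed.

Definition merge_at i l := take i l ++ nth 0 l i * nth 0 l i.+1 :: drop i.+2 l.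

Lemma bar_sum (F : A -> seq A -> V) m a l : bar F m (a :: l) =
  \sum_(i < size l) (-1) ^+ i *: F m (merge_at i (a :: l))
  + (-1) ^+ size l *: F (last a l * m) (belast a l).
Proof.
elim: l F a => [|b l IH] F a; first by rewrite big_ord0 add0r expr0 scale1r.
rewrite bar2 IH big_ord_recl /= expr0 scale1r /merge_at /= drop0 exprS mulN1r scaleNr.
rewrite opprD addrA; congr (_ + _ - _); rewrite -sumrN; apply: eq_bigr => i _.
by rewrite /bump /= add1n exprS mulN1r scaleNr.
Qed.

Lemma hd_sum (f : seq A -> V) x a s : hd f [:: x, a & s] =
  \sum_(i < (size s).+1) (-1) ^+ i *: f (merge_at i [:: x, a & s])
  + (-1) ^+ (size s).+1 *: f (last a s * x :: belast a s).
Proof.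
rewrite /hd bar_sum big_ord_recl /= expr0 scale1r {2}/merge_at /= drop0.
rewrite opprD addrA exprS mulN1r scaleNr; congr (_ + _ - _).
rewrite -sumrN; apply: eq_bigr => i _.
by rewrite /bump /= add1n exprS mulN1r scaleNr.
Qed.

Lemma face_merge_at n (a : {ffun 'I_n.+2 -> A}) (i : 'I_n.+1) :
  ffun_seq (hoch_face (widen_ord (leqnSn _) i) a) = merge_at i (ffun_seq a).
Proof.
have ii := ltn_ord i.
have st : size (take i (ffun_seq a)) = i.
  by rewrite size_take size_ffun_seq ifT // ltnS ltnW.
apply: (@eq_from_nth _ 0).
  rewrite size_cat st /= size_drop !size_ffun_seq; lia.
rewrite size_ffun_seq => j lt_jn.
rewrite (nth_ffun_seq _ (Ordinal lt_jn)) ffunE ifF; last first.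
  by apply/eqP => /(congr1 (@nat_of_ord _)) /=; lia.
have e0 : a (lift ord_max (Ordinal lt_jn)) = nth 0 (ffun_seq a) j.
  by rewrite -nth_ffun_seq lift_max.
have e1 : a (lift ord0 (Ordinal lt_jn)) = nth 0 (ffun_seq a) j.+1.
  by rewrite -nth_ffun_seq lift0.
rewrite e0 e1 nth_cat st /=; case: ltngtP => [ji|ij|ji].
- by rewrite nth_take.
- rewrite -[(j - i)%N]prednK ?subn_gt0 //= nth_drop; congr (nth _ _ _); lia.
by rewrite ji subnn.
Qed.

Lemma face_last n (a : {ffun 'I_n.+2 -> A}) x b s : ffun_seq a = [:: x, b & s] ->
  ffun_seq (hoch_face ord_max a) = last b s * x :: belast b s.
Proof.
move=> ea; have sn : size s = n by have := size_ffun_seq a; rewrite ea => -[].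
apply: (@eq_from_nth _ 0); rewrite size_ffun_seq.
  by rewrite /= size_belast sn.
move=> j lt_jn; rewrite (nth_ffun_seq _ (Ordinal lt_jn)) ffunE eqxx -val_eqE /=.
have lt : (n.+1 < n.+2)%N by [].
case: j lt_jn => [|j] lt_jn /=.
  rewrite -!nth_ffun_seq ea /=; congr (_ * _).
  by rewrite -sn; exact: (nth_last 0 (b :: s)).
rewrite -nth_ffun_seq lift_max ea /= [in LHS]lastI nth_rcons size_belast sn ifT //.
Qed.

Lemma hd_tens n (f : seq A -> V) (a : {ffun 'I_n.+2 -> A}) : hd f (ffun_seq a) =
  \sum_(i < n.+2) (-1) ^+ i *: f (ffun_seq (hoch_face i a)).
Proof.
have := size_ffun_seq a; case E : (ffun_seq a) => [|x [|b s]] // [sn].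
rewrite hd_sum [RHS]big_ord_recr /= (face_last E) sn; congr (_ + _).
by apply: eq_bigr => i _; rewrite face_merge_at E.
Qed.

Lemma hd_bd n (f : seq A -> V) x : hcochain n f ->
  tlift (n := n.+1) f (hoch_bd x) = tlift (n := n.+2) (hd f) x.
Proof.
move=> [mf _]; have md := hd_mlin mf.
apply: (tens_ext (phi := fun x => tlift f (hoch_bd x))) x => [c x y||a].
- by rewrite linearP (tlift_linear mf).
- exact: tlift_linear.
rewrite hoch_bdE tliftE // hd_tens; have lf := tlift_linear (n := n.+1) mf.
elim/big_ind2: _ => [|x1 x2 y1 y2 <- <-|i _]; [exact: lin0|exact: linD|].
by rewrite (linZ lf) tliftE.
Qed.

End Lift.
End Tensors.

(** * Hochschild homology of a colour Weyl algebra *)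

Lemma lmod_iso_inv (k : fieldType) (V W : lmodType k) (f : V -> W) : linear f ->
  (forall x, f x = 0 -> x = 0) -> (forall y, exists x, f x = y) -> lmod_iso W V.
Proof.
move=> lf inj onto; have [g gK] := choice onto.
have injf x y : f x = f y -> x = y.
  by move=> e; apply/eqP; rewrite -subr_eq0; apply/eqP/inj; rewrite linB // e subrr.
have lg : linear g by move=> c x y; apply: injf; rewrite lf !gK.
pose gl : {linear W -> V} := HB.pack g (GRing.isLinear.Build k W V _ g lg).
exists gl; exists f => // x.
exact/injf/gK.
Qed.

Lemma lmod_iso0 (k : fieldType) (V : lmodType k) : (forall x : V, x = 0) ->
  lmod_iso V ('rV[k]_0 : lmodType k).
Proof.
move=> V0; apply: (@lmod_iso_inv k 'rV[k]_0 V (fun=> 0)) => [c x y|x _|y].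
- by rewrite scaler0 addr0.
- by rewrite [x]thinmx0.
- by exists 0; rewrite [y]V0.
Qed.

Lemma lspan_closed (k : fieldType) (V : lmodType k) (S : V -> Prop) v :
  S 0 -> (forall c x y, S x -> S y -> S (c *: x + y)) -> lspan S v -> S v.
Proof. by move=> S0 SD h; elim: h => {v} [v||c x y _ Sx _ Sy] //; apply: SD. Qed.

Section HochschildHomology.
Variables (k : fieldType) (A : algType k) (U : zmodType) (M : nat).
Variable z : color_weyl A U M.
Hypothesis char0 : [pchar k] =i pred0.

Lemma lspan_im (X Y : lmodType k) (f : X -> Y) y : linear f ->
  lspan (fun v => exists u, v = f u) y -> exists u, y = f u.
Proof.
move=> lf; apply: lspan_closed => [|c x x' [u ->] [u' ->]].
  by exists 0; rewrite lin0.
by exists (c *: u + u'); rewrite lf.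
Qed.

Lemma hd_tfun (V : lmodType k) n (phi : tensorpow A n.+1 -> V) : linear phi ->
  forall a, hd (tfun phi) (ffun_seq a) = phi (hoch_bd (tens a)).
Proof.
move=> lp a; have Cf := tfun_cochain lp.
rewrite -(tliftE _ (hd_mlin Cf.1)) -(hd_bd _ Cf); apply: tens_ext => //.
  exact: tlift_linear Cf.1.
by move=> b; rewrite (tliftE _ Cf.1) tfunE.
Qed.

Lemma hcochain_tens (V : lmodType k) n (f g : seq A -> V) :
  hcochain n f -> hcochain n g ->
  (forall a : {ffun 'I_n.+1 -> A}, f (ffun_seq a) = g (ffun_seq a)) -> f = g.
Proof.
move=> [_ zf] [_ zg] e; apply/funext => l.
have [sl|nl] := eqVneq (size l) n.+1; last by rewrite zf // zg.
by rewrite -(seq_ffunK sl) e.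
Qed.

Lemma hd_tfun0 (V : lmodType k) n (phi : tensorpow A n.+1 -> V) : linear phi ->
  (forall x, phi (hoch_bd x) = 0) -> hd (tfun phi) = 0.
Proof.
move=> lp p0; apply: (@hcochain_tens _ n.+1).
- exact: hd_cochain (tfun_cochain lp).
- exact: hcochain0.
- by move=> a; rewrite hd_tfun // p0.
Qed.

Lemma coker_bd (V : lmodType k) n (S : V -> Prop) (f : tensorpow A n -> V) x :
  (S = fun v => exists u, v = f u) -> quot_proj S (f x) = 0.
Proof.
move=> ->; rewrite -[RHS](linear0 (quot_proj _)); apply/quot_projP.
by rewrite subr0; apply: lspan_gen; exists x.
Qed.

Local Notation im n := (fun v => exists u, v = @hoch_bd k A n u).

Lemma coker_proj n (x : tensorpow A n.+1) :
  quot_proj (im n) x = 0 -> exists u, x = hoch_bd u.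
Proof.
move=> e; have /quot_projP : quot_proj (im n) x = quot_proj (im n) 0.
  by rewrite e linear0.
by rewrite subr0; apply: lspan_im; exact: linearP.
Qed.

(** Applied to the universal cocycle, the projection of the chains to their
    quotient by the boundaries: it is a coboundary, so it kills the cycles. *)
Lemma cycle_boundary m (x : tensorpow A m.+2) : m.+1 <> M ->
  hoch_bd x = 0 -> exists u, x = hoch_bd u.
Proof.
move=> nM bx; apply: coker_proj; pose phi := quot_proj (im m.+1).
have lp : linear phi by exact: linearP.
have Cf := tfun_cochain lp.
have df : hd (tfun phi) = 0 by apply: hd_tfun0 => // y; exact: coker_bd.
have [g Cg dg] := hochschild_vanish z char0 nM Cf df.
transitivity (tlift (n := m.+1) g (hoch_bd x)); last first.
  by rewrite bx (lin0 (tlift_linear Cg.1)).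
rewrite (hd_bd _ Cg) dg; apply: tens_ext => //; first exact: tlift_linear Cf.1.
by move=> a; rewrite (tliftE _ Cf.1) tfunE.
Qed.

Lemma HH_vanish n : n <> M -> forall x : HH A n, x = 0.
Proof.
case: n => [|m] nM x.
  rewrite -[x]quot_reprK; pose phi := quot_proj (im 0).
  have lp : linear phi by exact: linearP.
  have df : hd (tfun phi) = 0 by apply: hd_tfun0 => // y; exact: coker_bd.
  have /= f0 := hochschild_vanish z char0 nM (tfun_cochain lp) df.
  apply: (tens_ext (phi := phi) (psi := fun=> 0)) => // [c u v|a].
    by rewrite scaler0 addr0.
  by rewrite -tfunE f0.
rewrite -[x]quot_reprK; set y := quot_repr x.
have /eqP by_ : lker_val y \in lker_pred _ := valP y.
have [u yu] := cycle_boundary nM by_.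
apply/eqP; rewrite -(linear0 (quot_proj _)); apply/eqP/quot_projP; rewrite subr0.
by apply: lspan_gen; exists u.
Qed.

Section Top.
Variable m : nat.
Hypothesis Mm : M = m.+1.

(** The universal cocycle is cohomologous to a multiple of phi, so a cycle is a
    boundary as soon as phi vanishes on it. If x1 has phi x1 = 1, then modulo the
    image of the kernel of phi the differential becomes phi times the class of
    the boundary of x1, so this class is 0: x1 can be corrected to a cycle by an
    element of the kernel of phi. *)
Lemma top_cycle : exists (phi : tensorpow A m.+2 -> k^o) (x0 : tensorpow A m.+2),
  [/\ linear phi, hoch_bd x0 = 0, phi x0 = 1,
      forall u, phi (hoch_bd u) = 0 &
      forall x, hoch_bd x = 0 -> phi x = 0 -> exists u, x = hoch_bd u].
Proof.
have [f []] := hochschild_top z char0; rewrite Mm => Cf df top.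
pose phi := tlift (n := m.+2) f; have lphi : linear phi := tlift_linear Cf.1.
have phi_bd u : phi (hoch_bd u) = 0.
  rewrite /phi (hd_bd _ Cf) df; apply: (tens_ext (psi := fun=> 0)).
  - exact: tlift_linear (hcochain0 A k^o 0).1.
  - by move=> c x y; rewrite scaler0 addr0.
  - by move=> a; rewrite (tliftE _ (hcochain0 A k^o 0).1).
have bdry x : hoch_bd x = 0 -> phi x = 0 -> exists u, x = hoch_bd u.
  move=> bx px; apply: coker_proj; pose pr := quot_proj (im m.+1).
  have lp : linear pr by exact: linearP.
  have Cp := tfun_cochain lp.
  have dp : hd (tfun pr) = 0 by apply: hd_tfun0 => // y; exact: coker_bd.
  have [ex _] := top (quotmod (im m.+1)); have [v [g Cg dg]] := ex _ Cp dp.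
  transitivity (phi x *: v + tlift (n := m.+1) g (hoch_bd x)); last first.
    by rewrite px bx scale0r add0r (lin0 (tlift_linear Cg.1)).
  have lg := tlift_linear (n := m.+1) Cg.1.
  apply: (tens_ext (phi := pr) (psi := fun x => phi x *: v + tlift g (hoch_bd x))).
  - exact: linearP.
  - move=> c y y'; rewrite lphi linearP lg scalerDl scalerDr addrACA scalerA.
    by [].
  move=> a; rewrite (hd_bd _ Cg) dg.
  have Cd : mlin1 (tfun pr - (fun l => f l *: v)) by rewrite -dg; apply: hd_mlin Cg.1.
  rewrite (tliftE _ Cd) /phi (tliftE _ Cf.1).
  by rewrite -[(_ - _) _]/(tfun pr _ - f _ *: v) tfunE addrC subrK.
(* otherwise phi is 0, and 1 times phi is a coboundary *)
have [x1 px1] : exists x1, phi x1 = 1.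
  have [[x px]|no] := pselect (exists x, phi x != 0).
    by exists ((phi x : k)^-1 *: x); rewrite (linZ lphi); exact: mulVf.
  have f0 : f = 0.
    apply: (hcochain_tens Cf (hcochain0 _ _ _)) => a.
    rewrite -(tliftE _ Cf.1); apply/eqP/negPn/negP => h; apply: no.
    by exists (tens a).
  have [_ top0] := top k^o.
  have /eqP : (1 : k^o) = 0.
    apply: (top0 1 m 0) => //; first exact: hcochain0.
    by rewrite hd0 f0; apply/funext => l; rewrite scale0r.
  by rewrite oner_eq0.
pose S := fun y : tensorpow A m.+1 => exists x, phi x = 0 /\ y = hoch_bd x.
have S_lin c y y' : S y -> S y' -> S (c *: y + y').
  move=> [x [px ->]] [x' [px' ->]]; exists (c *: x + x').
  by rewrite lphi px px' scaler0 addr0 linearP.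
have S0 : S 0 by exists 0; rewrite (lin0 lphi) linear0.
pose pr := quot_proj S; have lp : linear pr by exact: linearP.
have prS y : S y -> pr y = 0.
  move=> Sy; rewrite -[RHS](linear0 pr); apply/quot_projP.
  by rewrite subr0; apply: lspan_gen.
pose v := pr (hoch_bd x1).
(* the projection pr is a cochain, and its coboundary is phi times v *)
have v0 : v = 0.
  have [_ top0] := top (quotmod S).
  apply: (top0 v m (tfun pr)) => //; first exact: tfun_cochain.
  apply: (@hcochain_tens _ m.+1).
  - exact: hd_cochain (tfun_cochain lp).
  - split=> [l1 l2 c x y|l /Cf.2->]; last by rewrite scale0r.
    by rewrite Cf.1 scalerDl scalerA.
  move=> a; rewrite hd_tfun // -(tliftE _ Cf.1) -/phi.
  rewrite -(linZ lp) -linearZ /=; apply/eqP; rewrite -subr_eq0 -(linB lp) -linearB /=.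
  apply/eqP/prS; exists (tens a - (phi (tens a) : k) *: x1); split=> //.
  by rewrite (linB lphi) (linZ lphi) px1 -[_ *: 1]/(_ * 1) mulr1 subrr.
have [x2 [px2 e]] : S (hoch_bd x1).
  apply: (lspan_closed S0 S_lin); rewrite -[hoch_bd x1]subr0; apply/quot_projP.
  by rewrite linear0 -[LHS]/v.
exists phi, (x1 - x2); split=> //.
  by rewrite linearB /= e subrr.
by rewrite (linB lphi) px1 px2 subr0.
Qed.

Lemma HH_top : lmod_iso (HH A m.+1) (k^o : lmodType k).
Proof.
have [phi [x0 [lphi bx0 px0 phi_bd bdry]]] := top_cycle.
have x0k : x0 \in lker_pred (@hoch_bd k A m) by apply/eqP.
pose w : lkernel (@hoch_bd k A m) := LKernel x0k.
pose im2 := fun y : lkernel (@hoch_bd k A m) =>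
  exists u, lker_val y = @hoch_bd k A m.+1 u.
have valD c (y y' : lkernel (@hoch_bd k A m)) :
    lker_val (c *: y + y') = c *: lker_val y + lker_val y' by [].
pose cls (c : k^o) : HH A m.+1 := quot_proj im2 ((c : k) *: w).
have cyc (y : lkernel (@hoch_bd k A m)) : hoch_bd (lker_val y) = 0.
  by have /eqP := valP y.
apply: (lmod_iso_inv (f := cls)).
- by move=> c x y; rewrite /cls scalerDl -scalerA linearP.
- move=> c e; have /quot_projP : quot_proj im2 ((c : k) *: w) = quot_proj im2 0.
    by rewrite linear0.
  rewrite subr0 => lcw; have [||u cu] := lspan_closed _ _ lcw.
  + by exists 0; rewrite linear0.
  + move=> d y y' [u yu] [u' yu']; exists (d *: u + u').
    by rewrite valD yu yu' linearP.
  have := phi_bd u; rewrite -cu -[(c : k) *: w]addr0 valD addr0.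
  by rewrite (linZ lphi) px0 -[_ *: 1]/(_ * 1) mulr1.
move=> y; exists (phi (lker_val (quot_repr y))); rewrite /cls -[RHS]quot_reprK.
set y' := quot_repr y; apply/quot_projP/lspan_gen; apply: bdry => //.
rewrite valD -[lker_val (- y')]/(- lker_val y') linB // (linZ lphi) px0.
by rewrite -[_ *: 1]/(_ * 1) mulr1 subrr.
Qed.

End Top.

Theorem HH_color_weyl n : (0 < M)%N -> lmod_iso (HH A n)
  (if n == M then (k^o : lmodType k) else ('rV[k]_0 : lmodType k)).
Proof.
move=> M0; case: eqVneq => [->|/eqP nM]; last by apply/lmod_iso0/HH_vanish.
by have := @HH_top M.-1; rewrite prednK //; apply.
Qed.

End HochschildHomology.

(** * The quantum Weyl algebra *)

Section QuantumWeylColor.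
Variables (k : fieldType) (mu : nat) (q : qparams k mu).
Hypothesis char0 : [pchar k] =i pred0.
Local Notation F := (freealg k ('I_mu + 'I_mu)%type).
Local Notation A := (qweyl q).
Local Notation U := 'rV[int]_mu.
Local Notation e a := (delta_mx 0 a : U).
Implicit Types (a b : 'I_mu) (s t : ('I_mu + 'I_mu)%type) (u v : U).

Definition qw_proj : F -> A := @quotalg_proj k _ _ (@qweyl_proper k mu q).
Local Notation "\p" := qw_proj.

Lemma qw_projM f g : \p (f * g) = \p f * \p g.
Proof. by rewrite [RHS]quotalg_mulE. Qed.
Lemma qw_proj_linear : linear \p.
Proof. exact: quot_proj_is_linear. Qed.
Lemma qw_proj1 : \p 1 = 1. Proof. by []. Qed.
Lemma qw_rel r : qweyl_rel q r -> \p r = 0.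
Proof.
move=> rel; rewrite -[RHS](lin0 qw_proj_linear); apply/quot_projP.
rewrite subr0; apply: lspan_gen.
by have := IdealGen 1 1 rel; rewrite mul1r mulr1.
Qed.

Definition sgen s : A := \p (freegen k s).

Lemma qw_comm s t s' t' c : \p (freegen k s * freegen k t
  - c *: (freegen k s' * freegen k t')) = 0 -> sgen s * sgen t = c *: (sgen s' * sgen t').
Proof.
rewrite (linB qw_proj_linear) (linZ qw_proj_linear) !qw_projM.
by move/eqP; rewrite subr_eq0 => /eqP.
Qed.

Lemma qw_sym a b : q a b * q b a = 1.
Proof.
have [ab|ba|/ord_inj->] := ltngtP a b; first exact: qmat_anti.
  by rewrite mulrC qmat_anti.
by rewrite qmat_diag mulr1.
Qed.
Lemma qw_inv a b : (q a b)^-1 = q b a.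
Proof. by apply: (mulfI (qmat_neq0 q a b)); rewrite divff ?qmat_neq0 // qw_sym. Qed.

Definition sstar s : ('I_mu + 'I_mu)%type :=
  match s with inl a => inr a | inr a => inl a end.
Definition swt s : U := match s with inl a => e a | inr a => - e a end.
(** The bicharacter of the grading, in its first argument e a. *)
Definition qchar a u : k := \prod_l q a l ^ u 0 l.
Definition schi s u : k :=
  match s with inl a => qchar a u | inr a => (qchar a u)^-1 end.
Definition seps s : k := match s with inl _ => -1 | inr _ => 1 end.

Lemma qchar_neq0 a u : qchar a u != 0.
Proof. by apply/prodf_neq0 => l _; rewrite expfz_neq0 ?qmat_neq0. Qed.
Lemma qcharD a u v : qchar a (u + v) = qchar a u * qchar a v.
Proof.
by rewrite -big_split; apply: eq_bigr => l _; rewrite mxE expfzDr ?qmat_neq0.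
Qed.
Lemma qchar0 a : qchar a 0 = 1.
Proof. by rewrite /qchar big1 // => l _; rewrite mxE. Qed.
Lemma qcharN a u : qchar a (- u) = (qchar a u)^-1.
Proof.
apply: (mulfI (qchar_neq0 a u)).
by rewrite -qcharD subrr qchar0 divff ?qchar_neq0.
Qed.
Lemma qchar_delta a b : qchar a (e b) = q a b.
Proof.
rewrite /qchar (bigD1 b) //= big1 ?mulr1 => [|l /negbTE lb].
  by rewrite mxE !eqxx expr1z.
by rewrite mxE lb andbF expr0z.
Qed.
Definition qcharE := (qcharN, qchar_delta).

Lemma sgen_comm s t : sgen s * sgen t =
  schi s (swt t) *: (sgen t * sgen s) + (if t == sstar s then seps s else 0)%:A.
Proof.
have W a : sgen (inl a) * sgen (inr a) = sgen (inr a) * sgen (inl a) - 1.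
  have := qw_rel (@QWeylW k mu q a).
  rewrite (linD qw_proj_linear) (linB qw_proj_linear) !qw_projM qw_proj1.
  move/eqP; rewrite addr_eq0 => /eqP h; apply/eqP.
  by rewrite -subr_eq0 opprB addrA addrAC h addNr.
have eqE (f : 'I_mu -> ('I_mu + 'I_mu)%type) a b :
    injective f -> (f a == f b) = (a == b).
  by move=> injf; apply/eqP/eqP => [/injf|->].
case: s t => a [] b; rewrite /= !qcharE ?invrK.
- rewrite scale0r addr0; have [->|ab] := eqVneq a b; first by rewrite qmat_diag scale1r.
  by apply: qw_comm; apply: qw_rel; exact: QWeylXX.
- rewrite eqE => [|? ? []] //; have [->|ba] := eqVneq b a.
    by rewrite qmat_diag invr1 scale1r W scaleN1r.
  have ab : a != b by rewrite eq_sym.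
  rewrite (qw_comm (qw_rel (@QWeylYX k mu q a b ab))).
  by rewrite scalerA mulVf ?qmat_neq0 // scale1r scale0r addr0.
- rewrite eqE => [|? ? []] //; have [->|ba] := eqVneq b a.
    by rewrite qmat_diag invr1 !scale1r W subrK.
  rewrite qw_inv scale0r addr0; apply: qw_comm; apply: qw_rel; exact: QWeylYX.
rewrite scale0r addr0; have [->|ab] := eqVneq a b; first by rewrite qmat_diag scale1r.
by apply: qw_comm; apply: qw_rel; exact: QWeylYY.
Qed.

Lemma sgen_span (f : A) : lspan (fun g => exists w, g = \prod_(s <- w) sgen s) f.
Proof.
elim/quotalgW: f => f; rewrite -[quotalg_proj _ f]/(\p f).
have mulU (m n : {fmonom ('I_mu + 'I_mu)%type}) :
    (<< m >> : F) * << n >> = << fmmul m n >>.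
  by rewrite -[LHS]/(free_mul _ _) /free_mul unlock -[LHS]/(fgmul _ _) fgmulUU mulr1.
have pm (w : seq ('I_mu + 'I_mu)%type) : \p << FMonom w >> = \prod_(s <- w) sgen s.
  elim: w => [|s w IH]; first by rewrite big_nil -fmoneE; exact: qw_proj1.
  rewrite big_cons -IH -qw_projM /freegen unlock mulU; congr (\p << _ >>).
  by rewrite fmmulE fmuE.
rewrite [f]monalgE; elim: (enum_fset _) => [|m s IH].
  by rewrite big_nil (lin0 qw_proj_linear); exact: lspan_0.
rewrite big_cons.
have -> : << f@_m *g m >> = f@_m *: << m >> :> F.
  by apply/malgP => n; rewrite mcoeffZ !mcoeffU mulrnAr mulr1.
rewrite qw_proj_linear; apply: lspan_ZD IH; apply: lspan_gen.
by exists m; rewrite -pm fmK.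
Qed.

Lemma intr_neq0 (n : int) : n != 0 -> n%:~R != 0 :> k.
Proof.
move/pcharf0P: char0 => ch0; case: n => n n0; rewrite ?NegzE ?mulrNz ?oppr_eq0.
  by rewrite -[_%:~R]/(n%:R) ch0.
by rewrite -[_%:~R]/(n.+1%:R) ch0.
Qed.

Lemma sgen_euler u : u != 0 -> exists h (om : U -> k),
  [/\ forall v w, om (v + w) = om v + om w, om u != 0 &
      forall t, h * sgen t - sgen t * h = om (swt t) *: sgen t].
Proof.
move=> u0; have [l ul] : exists l, u 0 l != 0.
  apply/existsP; apply: contraNT u0; rewrite negb_exists => /forallP h.
  by apply/eqP/rowP => l; have := h l; rewrite negbK mxE => /eqP.
exists (sgen (inl l) * sgen (inr l)), (fun v => (v 0 l)%:~R); split.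
- by move=> v w; rewrite mxE intrD.
- exact: intr_neq0.
move=> t; rewrite -mulrA (sgen_comm (inr l) t) mulrDr -!scalerAr mulr1.
rewrite !mulrA (sgen_comm (inl l) t) mulrDl -!scalerAl mul1r scalerDr scalerA.
have inl_inj a b : (inl a == inl b :> 'I_mu + 'I_mu) = (b == a).
  by rewrite eq_sym; apply/eqP/eqP => [[]|->].
have inr_inj a b : (inr a == inr b :> 'I_mu + 'I_mu) = (b == a).
  by rewrite eq_sym; apply/eqP/eqP => [[]|->].
case: t => b /=; rewrite !qcharE ?invrK !mxE eqxx /=.
  rewrite scale0r scaler0 addr0 mulVf ?qmat_neq0 // scale1r addrAC subrr add0r.
  by rewrite inl_inj; case: eqP => [->|_]; rewrite ?scale1r ?scale0r.
rewrite scale0r addr0 mulfV ?qmat_neq0 // scale1r addrAC subrr add0r inr_inj.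
case: eqP => [->|_]; last by rewrite oppr0 scale0r scaler0 scale0r.
by rewrite qmat_diag scale1r.
Qed.

Lemma qweyl_color : color_weyl A U (mu + mu).
Proof.
pose dec (i : 'I_(mu + mu)) := fintype.split i.
have uK s : dec (unsplit s) = s by exact: unsplitK.
have eq_dec i s : (i == unsplit s) = (dec i == s).
  by apply/eqP/eqP => [->|<-]; rewrite ?uK ?splitK.
apply: (@ColorWeyl k A U (mu + mu) (fun i => sgen (dec i))
  (fun i => unsplit (sstar (dec i))) (fun i => swt (dec i))
  (fun i => schi (dec i)) (fun i => seps (dec i))).
- by move=> i; rewrite uK -[RHS]splitK; congr unsplit; rewrite /dec; case: (fintype.split i).
- by move=> i; rewrite uK; case: (dec i) => a /=; rewrite ?opprK.
- rewrite big_split_ord /= -big_split big1 //= => a _.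
  by rewrite /dec -/(unsplit (inl a)) -/(unsplit (inr a)) !unsplitK subrr.
- by move=> i u; case: (dec i) => a /=; rewrite ?invr_eq0 qchar_neq0.
- by move=> i u v; case: (dec i) => a /=; rewrite qcharD ?invfM.
- by move=> i; case: (dec i) => a /=; rewrite !qcharE qmat_diag ?invrK.
- by move=> i j; case: (dec i) (dec j) => a [] b /=; rewrite !qcharE ?invrK;
    rewrite -?invfM ?(mulrC (q a b)^-1) ?qw_sym ?invr1 //.
- by move=> i u; rewrite uK; case: (dec i) => a /=; rewrite ?mulVf ?mulfV ?qchar_neq0.
- by move=> i; case: (dec i) => a /=; rewrite ?oppr_eq0 oner_eq0.
- by move=> i j; rewrite sgen_comm eq_dec.
- move=> f; apply: (lspan_map (f := id)) (sgen_span f) => // _ [w ->].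
  apply: lspan_gen; exists (map unsplit w); rewrite big_map.
  by apply: eq_bigr => s _; rewrite uK.
- move=> u /sgen_euler[h [om [omD omu hs]]]; exists h, om; split=> // j; exact: hs.
Qed.

End QuantumWeylColor.

Theorem mainTheorem9 (k : fieldType) (hchar : [pchar k] =i pred0)
    (mu : nat) (hmu : (1 <= mu)%N) (Lambda : qparams k mu)
    (hfree : free_abelian_of_rank
               (mul_gen (fun c : k => exists i j : 'I_mu, c = Lambda i j))
               ((mu * (mu - 1)) %/ 2)%N)
    (n : nat) :
  lmod_iso (HH (qweyl Lambda) n)
           (if n == (2 * mu)%N then (k^o : lmodType k)
            else ('rV[k]_0 : lmodType k)).
Proof.
have := @HH_color_weyl k (qweyl Lambda) _ _ (qweyl_color Lambda hchar) hchar n.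
by rewrite addnn -mul2n muln_gt0 hmu; apply.
Qed.
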